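(* Let $G$ be a Garside group with positive monoid $G^+\neq\{1\}$, Garside element $\Delta$ and set $\mathcal D$ of simple elements. There is an algorithm that, given an element $g\in G$ (as a word over the finite alphabet $\mathcal D\cup\mathcal D^{-1}$), halts after finitely many steps and outputs the stable super summit set $[g]^{\mathrm{St}}$ of $g$, i.e. a finite list of words over $\mathcal D\cup\mathcal D^{-1}$ such that the set of elements of $G$ represented by these words is exactly $[g]^{\mathrm{St}}$.
   Context: Garside groups. Let $M$ be a monoid. An atom is an element $a\in M\setminus\{1\}$ such that $a=bc$ implies $b=1$ or $c=1$. For $a\in M$, $\|a\|$ is the supremum of the lengths of all expressions of $a$ as a product of atoms. $M$ is atomic if it is generated by its atoms and $\|a\|<\infty$ for all $a\in M$. In an atomic monoid, $a\le_L b$ means $ac=b$ for some $c\in M$, and $a\le_R b$ means $ca=b$ for some $c\in M$; these are partial orders. An atomic monoid $M$ is a Garside monoid if (i) $M$ is finitely generated; (ii) $M$ is left and right cancellative; (iii) $(M,\le_L)$ and $(M,\le_R)$ are lattices; (iv) there is an element $\Delta\in M$ (a Garside element) such that for each $a\in M$, $a\le_L\Delta$ if and only if $a\le_R\Delta$, and the set $\{a\in M: a\le_L\Delta\}$ generates $M$. The set of simple elements is $\mathcal D=\{a\in M: a\le_L\Delta\}$ (a finite set). A Garside monoid embeds in its group of fractions $G$, which is called a Garside group; $M$ is identified with its image in $G$, denoted $G^+$ and called the positive monoid. For $g,h\in G$, $g\le_L h$ means $gc=h$ for some $c\in G^+$. Invariants. For $g\in G$, $\inf(g)=\max\{r\in\mathbb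 Z:\Delta^r\le_L g\}$ and $\sup(g)=\min\{s\in\mathbb Z: g\le_L\Delta^s\}$. Let $[g]=\{h^{-1}gh: h\in G\}$ be the conjugacy class, $\inf_s(g)=\max\{\inf(h):h\in[g]\}$ and $\sup_s(g)=\min\{\sup(h):h\in[g]\}$. The super summit set is $[g]^S=\{h\in[g]:\inf(h)=\inf_s(g),\ \sup(h)=\sup_s(g)\}$ (finite and nonempty). The stable super summit set is $[g]^{\mathrm{St}}=\{h\in[g]^S: h^n\in[g^n]^S\text{ for all }n\ge1\}$. *)

(* Defs.v *)
From HB Require Import structures.
From mathcomp Require Import all_boot all_order ssrnum ssrint.
Set Implicit Arguments.
Unset Strict Implicit.
Unset Printing Implicit Defensive.
Local Open Scope group_scope.

Section GarsideMonoid.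
Variable M : monoidType.
Implicit Types (a b c : M) (s : seq M).

Definition generates (A : M -> Prop) : Prop :=
  forall a, exists2 s, (forall x, x \in s -> A x) & \prod_(x <- s) x = a.

Definition atom a : Prop := a <> 1 /\ forall b c, a = b * c -> b = 1 \/ c = 1.

Definition atomic_expr a s : Prop :=
  (forall x, x \in s -> atom x) /\ \prod_(x <- s) x = a.

(* the supremum ||a|| of the lengths of the expressions of a is finite *)
Definition finite_norm a : Prop :=
  exists N : nat, forall s, atomic_expr a s -> size s <= N.

Definition atomic_monoid : Prop := generates atom /\ forall a, finite_norm a.

Definition leL a b : Prop := exists c, a * c = b.
Definition leR a b : Prop := exists c, c * a = b.

Definition is_meet (le : M -> M -> Prop) a b m : Prop :=
  [/\ le m a, le m b & forall x, le x a -> le x b -> le x m].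
Definition is_join (le : M -> M -> Prop) a b j : Prop :=
  [/\ le a j, le b j & forall x, le a x -> le b x -> le j x].

(* only used for leL and leR, which are partial orders if M is atomic *)
Definition has_lattice_ops (le : M -> M -> Prop) : Prop :=
  forall a b, (exists m, is_meet le a b m) /\ (exists j, is_join le a b j).

Definition garside_element Delta : Prop :=
  (forall a, leL a Delta <-> leR a Delta) /\ generates (leL^~ Delta).

(* a Garside monoid with a chosen Garside element *)
Record garside_monoid Delta : Prop := GarsideMonoid {
  garside_atomic : atomic_monoid;
  garside_fin_gen : exists s, generates (fun x => x \in s);
  garside_cancelL : forall a b c, a * b = a * c -> b = c;
  garside_cancelR : forall a b c, b * a = c * a -> b = c;
  garside_latticeL : has_lattice_ops leL;
  garside_latticeR : has_lattice_ops leR;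
  garside_delta : garside_element Delta }.

(* d lists the simple elements (the elements a with a <=_L Delta), each once *)
Definition enumerates_simples Delta n (d : 'I_n -> M) : Prop :=
  injective d /\ forall a, leL a Delta <-> exists i, d i = a.

End GarsideMonoid.

(* The set of simple elements is always finite. *)
Lemma simples_finite (M : monoidType) (Delta : M) :
  garside_monoid Delta ->
  exists n (d : 'I_n -> M), enumerates_simples Delta d.
Proof.
case=> -[genA finN] [S genS] _ _ _ _ _.
have atomS a : atom a -> a \in S.
  case=> a1 irr; have [s sS pa] := genS a.
  elim: s sS pa => [|x s IH] sS; first by rewrite big_nil => /esym.
  rewrite big_cons => pa; have [x1|s1] := irr _ _ (esym pa).
    by apply: IH => [y ys|]; [apply: sS; rewrite inE ys orbT|rewrite -pa x1 mul1g].
  by rewrite -pa s1 mulg1; apply: sS; rewrite mem_head.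
have [N HN] := finN Delta.
pose L := iter N (fun t => [seq x * y | x <- 1 :: S, y <- t]) [:: 1 : M].
have inL (s : seq M) : (forall x, x \in s -> atom x) -> size s <= N ->
    \prod_(x <- s) x \in L.
  rewrite /L => sA; elim: N s sA {HN L} => [|k IH] [|x s] sA sz //.
  - by rewrite big_nil mem_head.
  - rewrite iterS -(mul1g (\prod_(x <- [::]) x)).
    by apply: allpairs_f; [exact: mem_head | exact: IH].
  - rewrite iterS big_cons; apply: allpairs_f.
      by rewrite inE (atomS x (sA _ (mem_head _ _))) orbT.
    by apply: IH => // y ys; apply: sA; rewrite inE ys orbT.
pose D := undup [seq a <- L | has (fun c => a * c == Delta) L].
have memD a : leL a Delta <-> a \in D.
  rewrite mem_undup mem_filter; split=> [[c acD]|/andP[/hasP[c _ /eqP acD] _]]; last by exists c.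
  have [s sA sa] := genA a; have [t tA tc] := genA c.
  have : size (s ++ t) <= N.
    apply: HN; split; last by rewrite big_cat /= sa tc.
    by move=> x; rewrite mem_cat => /orP[/sA|/tA].
  rewrite size_cat => sz.
  rewrite -sa inL ?(leq_trans (leq_addr _ _) sz) // andbT sa.
  apply/hasP; exists c; last by apply/eqP.
  by rewrite -tc inL // (leq_trans (leq_addl _ _) sz).
exists (size D), (fun i => tnth (in_tuple D) i); split=> [|a].
  by apply/tuple_uniqP; rewrite undup_uniq.
split=> [/memD aD|[i <-]]; last by apply/memD; exact: mem_tnth.
by have /tnthP[i ->] : a \in in_tuple D by []; exists i.
Qed.


(* G is the group of fractions of M, M being embedded in G by iota *)
Record group_of_fractions (M : monoidType) (G : groupType) (iota : M -> G) :
    Prop := GroupOfFractions {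
  fractions_morph : monoid_morphism iota;
  fractions_inj : injective iota;
  fractions_surj : forall g, exists a b, g = iota a / iota b }.

Definition zpow (G : groupType) (x : G) (r : int) : G :=
  match r with Posz n => x ^+ n | Negz n => x ^- n.+1 end.

Definition is_max (P : int -> Prop) (m : int) : Prop :=
  P m /\ forall r, P r -> (r <= m)%R.
Definition is_min (P : int -> Prop) (m : int) : Prop :=
  P m /\ forall r, P r -> (m <= r)%R.

Section GarsideGroup.
Variables (M : monoidType) (G : groupType) (iota : M -> G) (Delta : M).
Implicit Types (g h : G) (r s : int).

Definition leG g h : Prop := exists c : M, g * iota c = h.

(* is_inf g r reads inf(g) = r, and similarly below *)
Definition is_inf g r : Prop := is_max (fun r => leG (zpow (iota Delta) r) g) r.
Definition is_sup g s : Prop := is_min (fun s => leG g (zpow (iota Delta) s)) s.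

Definition conj_class g h : Prop := exists x, h = g ^ x.

Definition is_inf_s g r : Prop :=
  is_max (fun r => exists2 h, conj_class g h & is_inf h r) r.
Definition is_sup_s g s : Prop :=
  is_min (fun s => exists2 h, conj_class g h & is_sup h s) s.

Definition super_summit_set g h : Prop :=
  [/\ conj_class g h,
      exists2 r, is_inf h r & is_inf_s g r &
      exists2 s, is_sup h s & is_sup_s g s].

Definition stable_super_summit_set g h : Prop :=
  super_summit_set g h /\
  forall n : nat, 1 <= n -> super_summit_set (g ^+ n) (h ^+ n).

End GarsideGroup.


(* (i, false) stands for the i-th simple element, (i, true) for its inverse *)
Definition letter (n : nat) : Type := ('I_n * bool)%type.
Definition word (n : nat) : Type := seq (letter n).

Definition letter_val (M : monoidType) (G : groupType) (iota : M -> G)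
    (n : nat) (d : 'I_n -> M) (l : letter n) : G :=
  if l.2 then (iota (d l.1))^-1 else iota (d l.1).

Definition word_val (M : monoidType) (G : groupType) (iota : M -> G)
    (n : nat) (d : 'I_n -> M) (w : word n) : G :=
  \prod_(l <- w) letter_val iota d l.

(* Goedel numbers; CodeSeq.code is an effective bijection seq nat -> nat *)
Definition letter_code (n : nat) (l : letter n) : nat := ((l.1 : nat).*2 + l.2)%N.
Definition word_code (n : nat) (w : word n) : nat :=
  CodeSeq.code (map (@letter_code n) w).
Definition words_code (n : nat) (ws : seq (word n)) : nat :=
  CodeSeq.code (map (@word_code n) ws).


(* Programs for the partial recursive functions (Kleene's mu-recursive       *)
(* schemes). They carry no arity: they take a list of naturals, and an        *)
(* argument missing from the list reads as 0.                                 *)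
Inductive prog : Type :=
  | PZero                          (* 0 *)
  | PSucc                          (* x0 + 1 *)
  | PProj of nat                   (* x_i *)
  | PComp of prog & seq prog       (* f(g1(x),...,gk(x)) *)
  | PRec of prog & prog            (* h(0,y) = f(y), h(k+1,y) = g(k,h(k,y),y) *)
  | PMu of prog.                   (* the least k with f(k,x) = 0 *)

Fixpoint pointwise (A B : Type) (R : A -> B -> Prop) (s : seq A) (t : seq B) :
    Prop :=
  match s, t with
  | [::], [::] => True
  | x :: s', y :: t' => R x y /\ pointwise R s' t'
  | _, _ => False
  end.

Fixpoint rec_graph (base : nat -> Prop) (step : nat -> nat -> nat -> Prop)
    (k r : nat) : Prop :=
  match k with
  | 0 => base r
  | k'.+1 => exists2 r', rec_graph base step k' r' & step k' r' r
  end.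

(* returns p x r: the computation of p on x halts with result r *)
Fixpoint returns (p : prog) (x : seq nat) (r : nat) {struct p} : Prop :=
  match p with
  | PZero => r = 0
  | PSucc => r = (head 0 x).+1
  | PProj i => r = nth 0 x i
  | PComp f gs =>
      exists2 y, pointwise (fun g => returns g x) gs y & returns f y r
  | PRec f g =>
      rec_graph (returns f (behead x))
        (fun k r' => returns g (k :: r' :: behead x)) (head 0 x) r
  | PMu f =>
      returns f (r :: x) 0 /\
      forall k, k < r -> exists m, returns f (k :: x) m.+1
  end.

Lemma returns_functional p x r r' : returns p x r -> returns p x r' -> r = r'.
Proof.
move: p x r r'; fix IH 1 => -[||i|f gs|f g|f] x r r' /=; try by move=> -> ->.
- case=> y gy fy [y' gy' fy']; suff e : y = y' by subst; exact: IH fy fy'.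
  move: gs y y' gy gy' {fy fy'}; fix IHs 1 => -[|g gs] [|a y] [|b y'] //=.
  case=> ga gy [gb gy']; rewrite (IH _ _ _ _ ga gb).
  by rewrite (IHs _ _ _ gy gy').
- elim: (head 0 x) r r' => [|k IHk] r r' /=; first exact: IH.
  by case=> s hs rs [s' hs' rs']; rewrite -(IHk _ _ hs hs') in rs'; exact: IH rs rs'.
- case=> f0 fl [f0' fl'].
  case: (ltngtP r r') => // lt.
  + by have [m /(IH _ _ _ _ f0)] := fl' _ lt.
  + by have [m /(IH _ _ _ _ f0')] := fl _ lt.
Qed.

(* Main.v *)
From HB Require Import structures.
Require Import Defs.
From mathcomp Require Import all_boot all_order ssralg ssrnum ssrint intdiv.
From mathcomp Require Import boolp zify.
Set Implicit Arguments.
Unset Strict Implicit.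
Unset Printing Implicit Defensive.

(* Write N for the number of simple elements. Right multiplication by Delta   *)
(* and left multiplication by g preserve <=_L. Hence, if Delta^s <=_L g^m up  *)
(* to conjugacy, the meets y_c = /\_i g^i Delta^{-floor((i s + c)/m)} exist,  *)
(* and y_c <= g y_{c+s}. Conjugation by y_0 yields h with                     *)
(* Delta^{floor(k s/m)} <= h^k for all k, without spoiling any bound on the   *)
(* powers of g. The chain of the y_c has at most N members modulo Delta, so   *)
(* the slope s/m is already attained by some g^q with q <= N. Consequently a  *)
(* conjugate h of g is stable as soon as h^k is optimal for k <= N, and       *)
(* optimal elements for inf and sup at once exist. The conjugates of g in     *)
(* [Delta^-l, Delta^l], where l is the length of the given word, are linked   *)
(* by conjugations by simple elements inside this finite set (convexity), so  *)
(* boundedly long conjugators suffice; the algorithm lists these conjugates   *)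
(* and keeps the ones that beat all the others.                               *)

(** [inf_dominates g h] says that inf(h) is at least the inf of every conjugate of [g]. As sup(g) =
    -inf(g^-1), a conjugate [h] of [g] is stable iff, for all k, h^k dominates g^k and h^-k
    dominates g^-k ([stableP]). Three facts turn this into a finite search; [n] is the number of
    simple elements.

    Exponents up to [n] suffice ([inf_dominates_powers]). If some conjugate of g^m is above Delta^s,
    then by [small_root] some q <= n and p with p/q >= s/m satisfy Delta^p <=_L a conjugate of g^q.
    By [stabilize], one conjugate of [g] then has inf(g^k) >= floor(kp/q) for all k at once, so the
    bound for m follows from the bounds for q and for m mod q.

    A stable element exists ([stable_exists]). Applying [stabilize] to the best conjugate of g^(n!)
    makes all powers optimal for inf without spoiling an upper bound; this is done for g^-1, then
    for the new element.

    The candidates can be listed ([conjugatesP]). For a word of length l, its value and all its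
    stable conjugates lie in [Delta^-l, Delta^l]. Conjugates in this interval are joined by
    conjugations with letters inside it ([reach_conj]), and a path without repetitions has bounded
    length.

    Since a stable element is among the candidates, a candidate is stable iff no other one beats it
    for exponents k <= n and a bounded range of powers of Delta ([optimalP]). Each test Delta^r <=_L
    h^k is membership in the positive monoid, decided by [positive] from finite tables, and
    everything is assembled from [computable] functions ([comp_stable_words]). *)

Definition pcomp1 (p q : prog) : prog := PComp p [:: q].

Lemma returns_pcomp1 p q x y r :
  returns q x y -> returns p [:: y] r -> returns (pcomp1 p q) x r.
Proof. by move=> qy pr; exists [:: y]. Qed.

Definition pcomp2 (p q1 q2 : prog) : prog := PComp p [:: q1; q2].

Lemma returns_pcomp2 p q1 q2 x y1 y2 r :
  returns q1 x y1 -> returns q2 x y2 -> returns p [:: y1; y2] r ->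
  returns (pcomp2 p q1 q2) x r.
Proof. by move=> q1y q2y pr; exists [:: y1; y2]. Qed.

Lemma returns_rec f g k y r (F : nat -> nat) :
  returns f y (F 0) -> (forall i, i < k -> returns g (i :: F i :: y) (F i.+1)) ->
  r = F k -> returns (PRec f g) (k :: y) r.
Proof.
move=> f0 gS -> /=; elim: k gS => [|k IH] gS //=.
by exists (F k); [apply: IH => i lt; apply: gS; exact: ltnW | exact: gS].
Qed.

Definition const_prog (c : nat) : prog := iter c (pcomp1 PSucc) PZero.

Lemma returns_const c x : returns (const_prog c) x c.
Proof. by elim: c => //= c IH; exists [:: c]. Qed.

Definition double_prog := PRec PZero (pcomp1 PSucc (pcomp1 PSucc (PProj 1))).

Lemma returns_double k : returns double_prog [:: k] k.*2.
Proof.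
apply: (@returns_rec _ _ _ _ _ double) => // i _.
by exists [:: i.*2.+1] => //; split=> //; exists [:: i.*2].
Qed.

(** The step of [PRec] sees the counter and the previous value in front of the parameters, so
    position 3 holds the second branch. *)
Definition cond_prog := PRec (PProj 0) (PProj 3).

Lemma returns_cond k a b :
  returns cond_prog [:: k; a; b] (if k is 0 then a else b).
Proof.
by apply: (@returns_rec _ _ _ _ _ (fun k => if k is 0 then a else b)).
Qed.

Definition even_prog := PRec (const_prog 1)
  (PComp cond_prog [:: PProj 1; const_prog 1; PZero]).

Lemma returns_even k : returns even_prog [:: k] (~~ odd k).
Proof.
apply: (@returns_rec _ _ _ _ _ (fun k => ~~ odd k : nat)) => [|i _|] //.
  exact: returns_const.
exists [:: (~~ odd i : nat); 1; 0]; first by split=> //; split=> //; apply: returns_const.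
by have := returns_cond (~~ odd i) 1 0; rewrite /=; case: (odd i).
Qed.

Definition half_prog := PRec PZero
  (PComp cond_prog [:: pcomp1 even_prog (PProj 0); pcomp1 PSucc (PProj 1); PProj 1]).

Lemma returns_half k : returns half_prog [:: k] k./2.
Proof.
apply: (@returns_rec _ _ _ _ _ half) => // i _.
exists [:: (~~ odd i : nat); (i./2).+1; i./2].
  split; first by apply: returns_pcomp1 (returns_even i).
  by split=> //; exists [:: i./2].
have -> : i.+1./2 = if (~~ odd i : nat) is 0 then i./2.+1 else i./2.
  by rewrite /= uphalf_half; case: (odd i).
exact: returns_cond.
Qed.

(* the step of CodeSeq.code, so that the list x :: s and the pair (x, s) *)
(* have the same code *)
Definition pairn (a b : nat) : nat := 2 ^ a * b.*2.+1.

Definition pair_prog :=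
  PRec (pcomp1 PSucc double_prog) (pcomp1 double_prog (PProj 1)).

Lemma returns_pair a b : returns pair_prog [:: a; b] (pairn a b).
Proof.
apply: (@returns_rec _ _ _ _ _ (fun a => pairn a b)) => [|i _|] //.
  by rewrite /pairn mul1n; apply: returns_pcomp1 (returns_double b) _.
exists [:: pairn i b] => //.
by rewrite /pairn expnS -mulnA mul2n; exact: returns_double.
Qed.

Definition iter_half_prog := PRec (PProj 0) (pcomp1 half_prog (PProj 1)).

Lemma returns_iter_half k m : returns iter_half_prog [:: k; m] (iter k half m).
Proof.
apply: (@returns_rec _ _ _ _ _ (fun k => iter k half m)) => // i _.
by exists [:: iter i half m] => //; exact: returns_half.
Qed.

Lemma iter_half_pairn k a b : k <= a -> iter k half (pairn a b) = pairn (a - k) b.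
Proof.
elim: k => [|k IH] lt; first by rewrite subn0.
rewrite iterS IH ?(ltnW lt) // -(subnSK lt) /pairn expnS -mulnA mul2n.
exact: doubleK.
Qed.

(** Computes the 2-adic valuation: the least number of halvings after which the number is odd, which
    is when [even_prog] returns 0. *)
Definition fst_prog := PMu (pcomp1 even_prog iter_half_prog).

Lemma returns_fst a b : returns fst_prog [:: pairn a b] a.
Proof.
have even_iter k : returns (PComp even_prog [:: iter_half_prog]) [:: k; pairn a b]
    (~~ odd (iter k half (pairn a b))).
  by apply: returns_pcomp1 (returns_iter_half _ _) (returns_even _).
split=> [|k lt].
  have := even_iter a; rewrite iter_half_pairn // subnn /pairn mul1n /= odd_double.
  by [].
exists 0; have := even_iter k.
rewrite iter_half_pairn ?(ltnW lt) // -(subnSK lt) /pairn expnS -mulnA mul2n.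
by rewrite odd_double.
Qed.

Definition snd_prog := pcomp2 iter_half_prog (pcomp1 PSucc fst_prog) (PProj 0).

Lemma returns_snd a b : returns snd_prog [:: pairn a b] b.
Proof.
have fstS : returns (pcomp1 PSucc fst_prog) [:: pairn a b] a.+1.
  by exists [:: a]; first by split=> //; exact: returns_fst.
apply: (returns_pcomp2 (y2 := pairn a b) fstS) => //.
have := returns_iter_half a.+1 (pairn a b).
by rewrite iterS iter_half_pairn // subnn /pairn mul1n /= uphalf_double.
Qed.

Lemma pairn_inj a b a' b' : pairn a b = pairn a' b' -> (a, b) = (a', b').
Proof.
move=> e; have := returns_fst a b; have := returns_snd a b; rewrite e.
by move=> /(returns_functional (returns_snd _ _)) -> /(returns_functional (returns_fst _ _)) ->.
Qed.

(** * Computable functions between encoded types *)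

Class Code (T : Type) := enc : T -> nat.

#[export] Instance code_ord n : Code 'I_n := @nat_of_ord n.
#[export] Instance code_bool : Code bool := nat_of_bool.
#[export] Instance code_letter n : Code (letter n) := @letter_code n.
#[export] Instance code_pair A B {cA : Code A} {cB : Code B} : Code (A * B) :=
  fun x => pairn (enc x.1) (enc x.2).
#[export] Instance code_seq A {cA : Code A} : Code (seq A) :=
  fun s => CodeSeq.code (map enc s).

(** Functions of several variables are handled as functions on nested pairs, so programs with one
    input are enough. *)
Definition computable {A B : Type} {cA : Code A} {cB : Code B} (f : A -> B) : Prop :=
  exists p, forall a, returns p [:: enc a] (enc (f a)).

Lemma comp_id X {cX : Code X} : computable (fun x : X => x).
Proof. by exists (PProj 0). Qed.

Lemma comp_const X B {cX : Code X} {cB : Code B} (b : B) : computable (fun _ : X => b).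
Proof. by exists (const_prog (enc b)) => x; exact: returns_const. Qed.

Lemma comp_comp X A B {cX : Code X} {cA : Code A} {cB : Code B}
    (F : A -> B) (f : X -> A) : computable F -> computable f -> computable (fun x => F (f x)).
Proof.
move=> [p Hp] [q Hq]; exists (pcomp1 p q) => x.
exact: returns_pcomp1 (Hq x) (Hp _).
Qed.

Lemma comp_pair X A B {cX : Code X} {cA : Code A} {cB : Code B}
    (f : X -> A) (g : X -> B) : computable f -> computable g -> computable (fun x => (f x, g x)).
Proof.
move=> [p Hp] [q Hq]; exists (pcomp2 pair_prog p q) => x.
exact: returns_pcomp2 (Hp x) (Hq x) (returns_pair _ _).
Qed.

Lemma comp_fst X A B {cX : Code X} {cA : Code A} {cB : Code B}
    (f : X -> A * B) : computable f -> computable (fun x => (f x).1).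
Proof. by apply: comp_comp; exists fst_prog => x; exact: returns_fst. Qed.

Lemma comp_snd X A B {cX : Code X} {cA : Code A} {cB : Code B}
    (f : X -> A * B) : computable f -> computable (fun x => (f x).2).
Proof. by apply: comp_comp; exists snd_prog => x; exact: returns_snd. Qed.

Lemma comp_cons X A {cX : Code X} {cA : Code A} (f : X -> A) (g : X -> seq A) :
  computable f -> computable g -> computable (fun x => f x :: g x).
Proof.
move=> [p Hp] [q Hq]; exists (pcomp2 pair_prog p q) => x.
exact: returns_pcomp2 (Hp x) (Hq x) (returns_pair _ _).
Qed.

Lemma comp_comp2 X A B C {cX : Code X} {cA : Code A} {cB : Code B} {cC : Code C}
    (F : A -> B -> C) (f : X -> A) (g : X -> B) :
  computable (fun z : A * B => F z.1 z.2) -> computable f -> computable g ->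
  computable (fun x => F (f x) (g x)).
Proof. by move=> HF Hf Hg; apply: comp_comp HF (comp_pair Hf Hg). Qed.

(** Both branches get evaluated, which is harmless because both have programs that always halt. *)
Lemma comp_if X B {cX : Code X} {cB : Code B} (c : X -> bool) (f g : X -> B) :
  computable c -> computable f -> computable g -> computable (fun x => if c x then f x else g x).
Proof.
move=> [p Hp] [q Hq] [r Hr]; exists (PComp cond_prog [:: p; r; q]) => x.
exists [:: enc (c x); enc (g x); enc (f x)]; first by split; last split.
by have := returns_cond (c x) (enc (g x)) (enc (f x)); rewrite /enc /code_bool; case: (c x).
Qed.

Lemma returns_table (f : nat -> nat) N :
  exists p, forall k, k < N -> returns p [:: k] (f k).
Proof.
elim: N f => [|N IH] f; first by exists PZero.
have [p Hp] := IH (fun k => f k.+1).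
exists (PRec (const_prog (f 0)) (pcomp1 p (PProj 0))) => k lt.
apply: (@returns_rec _ _ _ _ _ f) => // [|i lti]; first exact: returns_const.
by exists [:: i] => //; apply: Hp; exact: leq_trans lti _.
Qed.

(** A function on a finite type is a finite table that a program can contain. This is how the
    structure of the monoid enters the algorithm. *)
Lemma comp_finite (T : finType) B {cT : Code T} {cB : Code B} (F : T -> B) :
  injective (enc : T -> nat) -> computable F.
Proof.
move=> inj.
have [tbl Htbl] := returns_table
  (* The default 0 fills the positions that encode no element. *)
  (fun k => if [pick t : T | enc t == k] is Some t then enc (F t) else 0)
  (\max_(t : T) enc t).+1.
exists tbl => t; have /Htbl : enc t < (\max_(t : T) enc t).+1 by exact: leq_bigmax.
by case: pickP => [t' /eqP/inj -> //|/(_ t)]; rewrite eqxx.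
Qed.

Lemma size_code (s : seq nat) : size s <= CodeSeq.code s.
Proof.
elim: s => //= a s IH; apply: leq_trans (leq_pmull _ _); last by rewrite expn_gt0.
by rewrite ltnS (leq_trans IH) // -addnn leq_addr.
Qed.

(** The state is the accumulator paired with the unread entries. The code of the list, which bounds
    its length by [size_code], serves as the number of rounds; the surplus rounds leave the state
    unchanged. *)
Lemma comp_foldl X A B {cX : Code X} {cA : Code A} {cB : Code B}
    (h : X -> B -> A -> B) (b : X -> B) (l : X -> seq A) :
  computable (fun z : X * (B * A) => h z.1 z.2.1 z.2.2) -> computable b -> computable l ->
  computable (fun x => foldl (h x) (b x) (l x)).
Proof.
move=> [ph Hh] [pb Hb] [pl Hl].
pose sg_prog := PRec PZero (const_prog 1).
have returns_sg k : returns sg_prog [:: k] (k != 0).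
  by apply: (@returns_rec _ _ _ _ _ (fun k => k != 0 : nat)) => // i _; exact: returns_const.
pose hd_prog := pcomp1 fst_prog (pcomp1 snd_prog (PProj 2)).
(* PRec serves as a lazy conditional: its step is only run when the list is  *)
(* nonempty, since fst_prog diverges on 0, the code of the empty list.       *)
pose step_prog := PRec (PProj 0)
  (pcomp2 pair_prog
    (pcomp1 ph (pcomp2 pair_prog (PProj 3)
                             (pcomp2 pair_prog (pcomp1 fst_prog (PProj 2)) hd_prog)))
    (pcomp1 snd_prog (pcomp1 snd_prog (PProj 2)))).
pose step x (st : B * seq A) :=
  if st.2 is a :: r then (h x st.1 a, r) else st.
have returns_step x st :
    returns step_prog [:: (enc st.2 != 0 : nat); enc st; enc x] (enc (step x st)).
  case: st => [acc [|a r]].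
    exact: (@returns_rec _ _ _ _ _ (fun=> enc (acc, [::]))).
  have -> : enc (acc, a :: r).2 != 0 by rewrite /enc /= muln_eq0 expn_eq0.
  apply: (@returns_rec _ _ _ _ _
    (fun i => enc (if i is 0 then (acc, a :: r) else (h x acc a, r)))) => // -[] // _.
  set st := (acc, a :: r).
  have st2 : returns (pcomp1 snd_prog (PProj 2)) [:: 0; enc st; enc st; enc x] (enc (a :: r)).
    by apply: returns_pcomp1 (returns_snd (enc acc) _).
  apply: returns_pcomp2 (returns_pair _ _).
    apply: returns_pcomp1 (Hh (x, (acc, a))).
    apply: (returns_pcomp2 (y1 := enc x)) (returns_pair _ _) => //.
    apply: returns_pcomp2 (returns_pair _ _).
      by apply: returns_pcomp1 (returns_fst _ (enc (a :: r))).
    exact: returns_pcomp1 st2 (returns_fst _ _).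
  exact: returns_pcomp1 st2 (returns_snd (enc a) _).
pose main := PRec (pcomp2 pair_prog pb pl)
  (PComp step_prog [:: pcomp1 sg_prog (pcomp1 snd_prog (PProj 1)); PProj 1; PProj 2]).
exists (pcomp1 fst_prog (pcomp2 main pl (PProj 0))) => x.
pose st i := iter i (step x) (b x, l x).
have returns_main : returns main [:: enc (l x); enc x] (enc (st (enc (l x)))).
  apply: (@returns_rec _ _ _ _ _ (fun i => enc (st i))) => // [|i _].
    exact: returns_pcomp2 (Hb x) (Hl x) (returns_pair _ _).
  exists [:: (enc (st i).2 != 0 : nat); enc (st i); enc x]; last exact: returns_step.
  split=> //; apply: returns_pcomp1 (returns_sg _).
  by apply: (returns_pcomp1 (y := enc (st i))) => //; exact: returns_snd.
apply: returns_pcomp1 (returns_fst _ (enc (st (enc (l x))).2)).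
have -> : foldl (h x) (b x) (l x) = (st (enc (l x))).1.
  have : size (l x) <= enc (l x) by rewrite -(size_map enc); exact: size_code.
  rewrite /st; elim: (l x) (b x) (enc _) => [|a r IH] acc k.
    by have -> : iter k (step x) (acc, [::]) = (acc, [::]) by elim: k => //= k ->.
  by case: k => // k /IH /= ->; rewrite -iterS iterSr.
by apply: returns_pcomp2 (Hl x) _ returns_main.
Qed.

Ltac comp_step :=
  cbv beta; lazymatch goal with
  | |- computable (fun x => x) => refine (@comp_id _ _)
  | |- computable (fun x => (@?f x, @?g x)) => refine (@comp_pair _ _ _ _ _ _ f g _ _)
  | |- computable (fun x => (@?f x).1) => refine (@comp_fst _ _ _ _ _ _ f _)
  | |- computable (fun x => (@?f x).2) => refine (@comp_snd _ _ _ _ _ _ f _)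
  | |- computable (fun x => @?f x :: @?g x) => refine (@comp_cons _ _ _ _ f g _ _)
  | |- computable fst => refine (@comp_fst _ _ _ _ _ _ (fun x => x) _)
  | |- computable snd => refine (@comp_snd _ _ _ _ _ _ (fun x => x) _)
  | _ => exact: comp_const
  end.

Lemma eq_comp X B {cX : Code X} {cB : Code B} (f g : X -> B) :
  f =1 g -> computable f -> computable g.
Proof. by move=> e [p Hp]; exists p => x; rewrite -e. Qed.

Lemma comp_rev X A {cX : Code X} {cA : Code A} (l : X -> seq A) :
  computable l -> computable (fun x => rev (l x)).
Proof.
move=> Hl; apply: (@eq_comp _ _ _ _ (fun x => foldl (fun r a => a :: r) [::] (l x))).
  by move=> x; rewrite -[in LHS](revK (l x)) foldl_rev; elim: (rev (l x)) => //= a s ->.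
apply: (comp_foldl (h := fun _ r a => a :: r)) (comp_const _) Hl.
by do !comp_step.
Qed.

Lemma comp_foldr X A B {cX : Code X} {cA : Code A} {cB : Code B}
    (h : X -> A -> B -> B) (b : X -> B) (l : X -> seq A) :
  computable (fun z : X * (A * B) => h z.1 z.2.1 z.2.2) -> computable b -> computable l ->
  computable (fun x => foldr (h x) (b x) (l x)).
Proof.
move=> Hh Hb /comp_rev Hl.
apply: (@eq_comp _ _ _ _ (fun x => foldl (fun r a => h x a r) (b x) (rev (l x)))).
  by move=> x; rewrite foldl_rev.
apply: (comp_foldl (h := fun x r a => h x a r)) Hb Hl.
apply: (comp_comp (F := fun z : X * (A * B) => h z.1 z.2.1 z.2.2)
  (f := fun z : X * (B * A) => (z.1, (z.2.2, z.2.1)))) Hh _.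
by do !comp_step.
Qed.

Lemma comp_map X A B {cX : Code X} {cA : Code A} {cB : Code B}
    (f : X -> A -> B) (l : X -> seq A) :
  computable (fun z : X * A => f z.1 z.2) -> computable l -> computable (fun x => map (f x) (l x)).
Proof.
move=> Hf Hl; apply: (@eq_comp _ _ _ _ (fun x => foldr (fun a s => f x a :: s) [::] (l x))).
  by move=> x; elim: (l x) => //= a s ->.
apply: (comp_foldr (h := fun x a s => f x a :: s)) (comp_const _) Hl.
comp_step; last by do !comp_step.
by apply: comp_comp2 Hf _ _; do !comp_step.
Qed.

Lemma comp_cat X A {cX : Code X} {cA : Code A} (s t : X -> seq A) :
  computable s -> computable t -> computable (fun x => s x ++ t x).
Proof.
move=> Hs Ht; apply: (@eq_comp _ _ _ _ (fun x => foldr cons (t x) (s x))).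
  by move=> x; elim: (s x) => //= a r ->.
by apply: (comp_foldr (h := fun _ a s => a :: s)) Ht Hs; do !comp_step.
Qed.

Lemma comp_flatten X A {cX : Code X} {cA : Code A} (l : X -> seq (seq A)) :
  computable l -> computable (fun x => flatten (l x)).
Proof.
move=> Hl; apply: (comp_foldr (h := fun _ a s => a ++ s)) (comp_const _) Hl.
by apply: comp_cat; do !comp_step.
Qed.

Lemma comp_filter X A {cX : Code X} {cA : Code A} (p : X -> A -> bool) (l : X -> seq A) :
  computable (fun z : X * A => p z.1 z.2) -> computable l ->
  computable (fun x => [seq a <- l x | p x a]).
Proof.
move=> Hp Hl; apply: (@eq_comp _ _ _ _
    (fun x => foldr (fun a s => if p x a then a :: s else s) [::] (l x))).
  by move=> x; elim: (l x) => //= a s ->.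
apply: (comp_foldr (h := fun x a s => if p x a then a :: s else s)) (comp_const _) Hl.
by apply: comp_if; [apply: comp_comp2 Hp _ _| |]; do !comp_step.
Qed.

Lemma comp_all X A {cX : Code X} {cA : Code A} (p : X -> A -> bool) (l : X -> seq A) :
  computable (fun z : X * A => p z.1 z.2) -> computable l -> computable (fun x => all (p x) (l x)).
Proof.
move=> Hp Hl; apply: (@eq_comp _ _ _ _
    (fun x => foldr (fun a (b : bool) => if p x a then b else false) true (l x))).
  by move=> x; elim: (l x) => //= a s ->; case: (p x a).
apply: (comp_foldr (h := fun x a (b : bool) => if p x a then b else false)) (comp_const _) Hl.
by apply: comp_if; [apply: comp_comp2 Hp _ _| |]; do !comp_step.
Qed.

(** * The algorithm *)

Section Algorithm.
(* Simple elements are represented by their indices: iD stands for Delta, i1  *)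
(* for 1, tau for conjugation by Delta, (cc i) i = Delta, and                 *)
(* (pp a b) a = (qq a b) b is the join of a and b for <=_R.                   *)
Variables (n : nat) (iD i1 : 'I_n) (tau cc : 'I_n -> 'I_n).
Variables (pp qq : 'I_n -> 'I_n -> 'I_n).
Notation wrd := (seq (letter n)).

(* computes (y, s) such that w = s y^-1, where y is a power of Delta *)
Definition fraction_step (l : letter n) (ys : seq 'I_n * seq 'I_n) :=
  if l.2 then (iD :: ys.1, map tau (cc l.1 :: ys.2)) else (ys.1, l.1 :: ys.2).

Definition fraction (w : wrd) : seq 'I_n * seq 'I_n :=
  foldr fraction_step ([::], [::]) w.

Definition residue_step (b : 'I_n) (st : 'I_n * seq 'I_n) :=
  (qq st.1 b, pp st.1 b :: st.2).

(* residue a y is the least z with y <=_R z a *)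
Definition residue (a : 'I_n) (y : seq 'I_n) : seq 'I_n :=
  (foldr residue_step (a, [::]) y).2.

(** With w = s y^-1, taking residues along the letters of [s] yields the least z with y <=_R z s.
    The value of [w] is positive iff z = 1, that is, iff all letters of z are 1. *)
Definition positive (w : wrd) : bool :=
  all (fun i => i == i1) (foldr residue (fraction w).1 (fraction w).2).

Definition winv (w : wrd) : wrd := rev [seq (l.1, ~~ l.2) | l <- w].

Definition wpow (w : wrd) (k : nat) : wrd := iter k (cat w) [::].

(* the words over s that are not longer than the list c *)
Definition words_upto (T U : Type) (s : seq T) (c : seq U) : seq (seq T) :=
  foldr (fun _ L => [::] :: flatten [seq [seq x :: u | u <- L] | x <- s]) [:: [::]] c.

(* The inner list bounds the number of elements of [Delta^-l, Delta^l], where *)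
(* l is the length of w, hence the length of a chain of distinct conjugates.  *)
Definition conjugates (w : wrd) : seq wrd :=
  [seq winv x ++ (w ++ x) |
     x <- words_upto (enum {: letter n}) (words_upto (enum {: letter n}) (w ++ w))].

Definition delta_words (w : wrd) : seq wrd :=
  words_upto [:: (iD, false); (iD, true)] (wpow w n).

(** If [r] evaluates to Delta^-t, this tests whether Delta^t <=_L h'^k implies Delta^t <=_L h^k. *)
Definition dominates (r h h' : wrd) (k : nat) : bool :=
  positive (r ++ wpow h' k) ==> positive (r ++ wpow h k).

Definition optimal (w h : wrd) : bool :=
  all (fun h' => all (fun r => all (fun k =>
      dominates r h h' k && dominates r (winv h) (winv h') k)
    (iota 1 n)) (delta_words w)) (conjugates w).

Definition stable_words (w : wrd) : seq wrd :=
  [seq h <- conjugates w | optimal w h].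

(** * Computability of the algorithm *)

Lemma letter_code_inj : injective (@letter_code n).
Proof.
move=> [i b] [j c]; rewrite /letter_code /= => e.
have bc : b = c by move/(congr1 odd): e; rewrite !oddD !odd_double; case: b; case: c.
by rewrite bc in e *; move/addIn/double_inj/val_inj: e => ->.
Qed.

Section Computability.
Context {X : Type} {cX : Code X}.

Lemma comp_letter (T : Type) {cT : Code T} (F : letter n -> T) (f : X -> letter n) :
  computable f -> computable (fun x => F (f x)).
Proof. by apply: comp_comp; apply: comp_finite; exact: letter_code_inj. Qed.

Lemma comp_ord (T : Type) {cT : Code T} (F : 'I_n -> T) (f : X -> 'I_n) :
  computable f -> computable (fun x => F (f x)).
Proof. by apply: comp_comp; apply: comp_finite; exact: val_inj. Qed.

Lemma comp_ord2 (F : 'I_n -> 'I_n -> 'I_n) (f g : X -> 'I_n) :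
  computable f -> computable g -> computable (fun x => F (f x) (g x)).
Proof.
apply: comp_comp2; apply: comp_finite => -[a b] [a' b'] /pairn_inj.
by case=> /val_inj -> /val_inj ->.
Qed.

End Computability.

Lemma comp_fraction : computable fraction.
Proof.
apply: (comp_foldr (h := fun _ => fraction_step)) (comp_const _) (@comp_id _ _).
apply: comp_if; first by apply: (comp_letter (snd)); do !comp_step.
  do ?comp_step => //.
  apply: (comp_map (f := fun _ => tau)).
    by apply: comp_ord; do !comp_step.
  apply: comp_cons; last by do !comp_step.
  by apply: (comp_letter (fun l => cc l.1)); do !comp_step.
apply: comp_pair; first by do !comp_step.
apply: comp_cons; last by do !comp_step.
by apply: (comp_letter (fst)); do !comp_step.
Qed.

Lemma comp_residue : computable (fun z : 'I_n * seq 'I_n => residue z.1 z.2).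
Proof.
apply: comp_snd.
apply: (comp_foldr (h := fun _ => residue_step) (b := fun z => (z.1, [::]))).
- rewrite /residue_step; comp_step; first by apply: comp_ord2; do !comp_step.
  by comp_step; [apply: comp_ord2|]; do !comp_step.
- by do !comp_step.
- by do !comp_step.
Qed.

Lemma comp_positive : computable positive.
Proof.
apply: (comp_all (p := fun _ i => i == i1)).
  by apply: (comp_ord (fun i => i == i1)); do !comp_step.
apply: (comp_foldr (h := fun _ => residue) (b := fun w => (fraction w).1)).
- by apply: comp_comp2 comp_residue _ _; do !comp_step.
- by apply: comp_fst comp_fraction.
- by apply: comp_snd comp_fraction.
Qed.

Lemma comp_winv : computable winv.
Proof.
apply: comp_rev; apply: (comp_map (f := fun _ l => (l.1, ~~ l.2) : letter n)).
  by apply: (comp_letter (fun l => (l.1, ~~ l.2) : letter n)); do !comp_step.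
exact: comp_id.
Qed.

Lemma comp_wpow k : computable (wpow^~ k).
Proof.
elim: k => [|k IH]; first exact: comp_const.
exact: (@comp_cat _ _ _ _ (fun w => w) (wpow^~ k) (@comp_id _ _) IH).
Qed.

Lemma comp_words_upto (X T U : Type) {cX : Code X} {cT : Code T} {cU : Code U}
    (s : seq T) (c : X -> seq U) : computable c -> computable (fun x => words_upto s (c x)).
Proof.
apply: (comp_foldr (h := fun _ _ L =>
    [::] :: flatten [seq [seq x :: u | u <- L] | x <- s]) (b := fun _ => [:: [::]])).
  apply: comp_cons; first exact: comp_const.
  apply: comp_flatten.
  apply: (comp_map (f := fun z x => [seq x :: u | u <- z.2.2])); last exact: comp_const.
  by apply: (comp_map (f := fun z u => z.2 :: u)); do !comp_step.
exact: comp_const.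
Qed.

Lemma comp_conjugates : computable conjugates.
Proof.
apply: (comp_map (f := fun w x => winv x ++ (w ++ x))).
  apply: comp_cat; last by apply: comp_cat; do !comp_step.
  by apply: comp_comp comp_winv _; do !comp_step.
do 2!apply: comp_words_upto.
by apply: comp_cat; exact: comp_id.
Qed.

Lemma comp_dominates (X : Type) {cX : Code X} k (r h h' : X -> wrd) :
  computable r -> computable h -> computable h' ->
  computable (fun x => dominates (r x) (h x) (h' x) k).
Proof.
have comp_test (f g : X -> wrd) : computable f -> computable g ->
    computable (fun x => positive (f x ++ wpow (g x) k)).
  move=> Hf Hg; apply: comp_comp comp_positive _; apply: comp_cat Hf _.
  exact: comp_comp (comp_wpow k) Hg.
by move=> Hr Hh Hh'; apply: comp_if; [exact: comp_test | exact: comp_test | exact: comp_const].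
Qed.

Lemma comp_optimal : computable (fun z : wrd * wrd => optimal z.1 z.2).
Proof.
apply: (comp_all (p := fun z h' => all (fun r => all (fun k => dominates r z.2 h' k &&
   dominates r (winv z.2) (winv h') k) (iota 1 n)) (delta_words z.1))).
  apply: (comp_all (p := fun z r => all (fun k => dominates r z.1.2 z.2 k &&
   dominates r (winv z.1.2) (winv z.2) k) (iota 1 n))).
    (* The exponents do not depend on the input, so their list is unrolled into the program. *)
    move: (iota 1 n) => ks; elim: ks => [|k ks IH]; first exact: comp_const.
    apply: comp_if IH _; last exact: comp_const.
    apply: comp_if; last exact: comp_const.
      by apply: comp_dominates; do !comp_step.
    by apply: comp_dominates; do ?apply: comp_comp comp_winv _; do !comp_step.
  apply: comp_words_upto; apply: (comp_comp (comp_wpow n)); do !comp_step.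
by apply: comp_comp comp_conjugates _; do !comp_step.
Qed.

Lemma comp_stable_words : computable stable_words.
Proof.
apply: (comp_filter (p := optimal)) comp_conjugates.
exact: comp_optimal.
Qed.

End Algorithm.

Lemma mem_words_upto (T : eqType) (U : Type) (s : seq T) (c : seq U) (u : seq T) :
  size u <= size c -> {subset u <= s} -> u \in words_upto s c.
Proof.
elim: c u => [|b c IH] [|a u] //= uc us; rewrite inE //=.
apply/flattenP; exists (map (cons a) (words_upto s c)).
  by apply/mapP; exists a => //; apply: us; exact: mem_head.
by apply: map_f; apply: IH => // e eu; apply: us; rewrite inE eu orbT.
Qed.

Local Open Scope group_scope.

(** * The order on a Garside group *)

Section Zpow.
Variable G : groupType.
Implicit Types (x : G) (r s : int).

Lemma zpow_nat x (k : nat) : zpow x k = x ^+ k.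
Proof. by []. Qed.

Lemma zpowN x r : zpow x (- r)%R = (zpow x r)^-1.
Proof.
case: r => [[|k]|k]; rewrite ?NegzE ?GRing.opprK //=; first by rewrite invg1.
by rewrite invgK.
Qed.

Lemma zpowS x r : zpow x (r + 1)%R = zpow x r * x.
Proof.
case: r => [k|k] /=; first by rewrite addn1 expgSr.
have -> : (Negz k + 1)%R = (- k%:Z)%R by lia.
by rewrite zpowN /= expgS invgM mulgVK.
Qed.

Lemma zpowD x r s : zpow x (r + s)%R = zpow x r * zpow x s.
Proof.
have nat_case r' k : zpow x (r' + Posz k)%R = zpow x r' * zpow x k.
  elim: k => [|k IH]; first by rewrite GRing.addr0 mulg1.
  have -> : (r' + k.+1)%R = (r' + k + 1)%R by lia.
  by rewrite zpowS IH -mulgA -[_ * x]expgSr.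
case: s => k; first exact: nat_case.
rewrite NegzE zpowN -[LHS](mulgK (zpow x k.+1)) -nat_case.
by congr (zpow _ _ * _); lia.
Qed.

End Zpow.

Section Garside.
Variables (M : monoidType) (G : groupType) (iota : M -> G) (Delta : M).
Variables (n : nat) (d : 'I_n -> M).
Hypothesis GM : garside_monoid Delta.
Hypothesis GF : group_of_fractions iota.
Hypothesis nontrivial : exists a : M, a <> 1.
Hypothesis Hd : enumerates_simples Delta d.

Notation D := (iota Delta).
Notation "g <<= h" := (leG iota g h) (at level 70).
Notation Dz := (zpow D).
Implicit Types (g h u v w : G) (r : int).

Lemma iotaM a b : iota (a * b) = iota a * iota b.
Proof. by case: GF => -[_ ->]. Qed.

Lemma iota1 : iota 1 = 1.
Proof. by case: GF => -[]. Qed.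

Lemma iota_inj : injective iota.
Proof. exact: fractions_inj GF. Qed.

Lemma le_iota c g : g <<= g * iota c.
Proof. by exists c. Qed.

Lemma ge1_iota c : 1 <<= iota c.
Proof. by exists c; rewrite mul1g. Qed.

Lemma ge1P g : 1 <<= g -> exists c, g = iota c.
Proof. by case=> c; rewrite mul1g => <-; exists c. Qed.

Lemma leG_refl g : g <<= g.
Proof. by exists 1; rewrite iota1 mulg1. Qed.

Lemma leG_trans h g u : g <<= h -> h <<= u -> g <<= u.
Proof. by case=> c <- [c' <-]; exists (c * c'); rewrite iotaM mulgA. Qed.

Lemma leG_mull x g h : g <<= h -> x * g <<= x * h.
Proof. by case=> c <-; exists c; rewrite mulgA. Qed.

Lemma leG_mul2l x g h : x * g <<= x * h <-> g <<= h.
Proof.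
by split=> [/(leG_mull x^-1)|]; [rewrite !mulKg | exact: leG_mull].
Qed.

Lemma leG_ge1 g h : g <<= h <-> 1 <<= g^-1 * h.
Proof. by rewrite -(leG_mul2l g 1) mulg1 mulVKg. Qed.

Lemma leG_ge1_mul g h : 1 <<= h -> g <<= g * h.
Proof. by move=> /(leG_mull g); rewrite mulg1. Qed.

Lemma leG_inv1 g : g <<= 1 <-> 1 <<= g^-1.
Proof. by rewrite leG_ge1 mulg1. Qed.

Lemma simple_dvd i : 1 <<= iota (d i) /\ iota (d i) <<= D.
Proof.
split; first exact: ge1_iota.
have /(Hd.2 _) [c <-] : exists j, d j = d i by exists i.
by rewrite iotaM; exact: le_iota.
Qed.

Lemma generated a : exists t : seq 'I_n, iota a = \prod_(i <- t) iota (d i).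
Proof.
have [s sS <-] := (garside_delta GM).2 a.
elim: s sS => [|a' s IH] sS; first by exists [::]; rewrite !big_nil iota1.
have [i <-] := (Hd.2 a').1 (sS a' (mem_head _ _)).
have [t et] := IH (fun b bs => sS b (mem_behead (s := a' :: s) bs)).
by exists (i :: t); rewrite !big_cons iotaM et.
Qed.

(* if a b = Delta then b c = Delta for some c, whence a Delta = Delta c *)
Lemma simple_conjD i : (exists j, iota (d i) ^ D = iota (d j)) /\
  exists j, iota (d i) ^ D^-1 = iota (d j).
Proof.
have /(Hd.2 _) Li : exists j, d j = d i by exists i.
have Ri := ((garside_delta GM).1 _).1 Li.
split.
  have [b ab] := Li; have /((garside_delta GM).1 _) [c bc] : leR b Delta by exists (d i).
  have /(Hd.2 _) [j jc] : leL c Delta by apply/((garside_delta GM).1 _); exists b.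
  exists j; rewrite jc /conjg; apply: (mulgI D); rewrite mulVKg.
  by rewrite -[in LHS]bc -ab !iotaM !mulgA.
have [b ba] := Ri; have /((garside_delta GM).1 _) [c cb] : leL b Delta by exists (d i).
have /(Hd.2 _) [j jc] : leL c Delta by exists b.
exists j; rewrite jc /conjg invgK; apply: (mulIg D); rewrite mulgA mulgVK.
by rewrite -[in LHS]cb -ba !iotaM !mulgA.
Qed.

(** Conjugation by Delta or its inverse sends simple elements to simple elements, and these generate
    the positive monoid. *)
Lemma ge1_conjD g r : 1 <<= g -> 1 <<= g ^ Dz r.
Proof.
have ge1_prod (t : seq 'I_n) (x : G) :
    (forall i, exists j, iota (d i) ^ x = iota (d j)) ->
    1 <<= (\prod_(i <- t) iota (d i)) ^ x.
  move=> Hx; elim: t => [|i t IH]; first by rewrite big_nil conj1g; exact: leG_refl.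
  rewrite big_cons conjMg; have [j ->] := Hx i.
  by apply: leG_trans (ge1_iota _) (leG_ge1_mul _ IH).
have step (x : G) : (forall i, exists j, iota (d i) ^ x = iota (d j)) ->
    forall g' k, 1 <<= g' -> 1 <<= g' ^ (x ^+ k).
  move=> Hx g' k; elim: k g' => [|k IH] g' g1; first by rewrite conjg1.
  rewrite expgS conjgM; apply: IH; have [c ->] := ge1P g1.
  by have [t ->] := generated c; exact: ge1_prod.
case: r => k; first by apply: step => i; case: (simple_conjD i).
by rewrite /= -expVgn; apply: step => i; case: (simple_conjD i).
Qed.

(** The quotient of the two right sides by the left ones is g^-1 h conjugated by Delta^r, and
    [ge1_conjD] applies. *)
Lemma leG_mulDr g h r : g <<= h -> g * Dz r <<= h * Dz r.
Proof.
move/leG_ge1/(@ge1_conjD _ r) => H; apply/leG_ge1.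
by rewrite invgM -mulgA [_^-1 * (h * _)]mulgA.
Qed.

Lemma leG_mul2Dr g h r : g * Dz r <<= h * Dz r <-> g <<= h.
Proof.
split=> [/(@leG_mulDr _ _ (- r)%R)|]; last exact: leG_mulDr.
by rewrite -!mulgA -zpowD GRing.addrN !mulg1.
Qed.

Lemma leG_D_mul g r h s : Dz r <<= g -> Dz s <<= h -> Dz (r + s)%R <<= g * h.
Proof.
move=> rg sh; rewrite zpowD; apply: leG_trans (leG_mulDr _ rg) _.
exact: leG_mull.
Qed.

Lemma leG_mul_D g r h s : g <<= Dz r -> h <<= Dz s -> g * h <<= Dz (r + s)%R.
Proof.
move=> rg sh; rewrite zpowD; apply: leG_trans (leG_mulDr _ rg).
exact: leG_mull.
Qed.

Lemma leG_DX g r k : Dz r <<= g -> Dz (r * Posz k)%R <<= g ^+ k.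
Proof.
move=> rg; elim: k => [|k IH]; first by rewrite GRing.mulr0; exact: leG_refl.
have -> : (r * Posz k.+1)%R = (r + r * Posz k)%R by lia.
by rewrite expgS; exact: leG_D_mul.
Qed.

Lemma leG_XD g r k : g <<= Dz r -> g ^+ k <<= Dz (r * Posz k)%R.
Proof.
move=> rg; elim: k => [|k IH]; first by rewrite GRing.mulr0; exact: leG_refl.
have -> : (r * Posz k.+1)%R = (r + r * Posz k)%R by lia.
by rewrite expgS; exact: leG_mul_D.
Qed.

Lemma leG_Dz r s : (r <= s)%R -> Dz r <<= Dz s.
Proof.
move=> rs; have -> : s = (r + Posz `|s - r|%N)%R by lia.
rewrite zpowD; apply: leG_ge1_mul; elim: `|_|%N => [|k IH]; first exact: leG_refl.
by rewrite zpow_nat expgS; apply: leG_trans (ge1_iota _) (leG_ge1_mul _ IH).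
Qed.

Lemma leG_invD g r : Dz r <<= g^-1 <-> g <<= Dz (- r)%R.
Proof.
rewrite -(leG_mul2l g) mulgV -(leG_mul2Dr _ 1 (- r)%R) mul1g -mulgA -zpowD.
by rewrite GRing.addrN mulg1.
Qed.

Lemma leG_inv_le g r : g^-1 <<= Dz r <-> Dz (- r)%R <<= g.
Proof. by have := leG_invD g^-1 (- r)%R; rewrite invgK GRing.opprK => ->. Qed.

(** * Bounded chains and antisymmetry *)

(** Every nontrivial factor is a product of at least one atom, so the norm of [c] is a bound. *)
Lemma chain_bound (c : M) : exists N, forall t : seq M,
  (forall a, a \in t -> a <> 1) -> \prod_(a <- t) a = c -> size t <= N.
Proof.
have [[genA finN] _ _ _ _ _ _] := GM.
have [N HN] := finN c; exists N => t t1 tc.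
suff [s [sA ps szs]] : exists s, [/\ forall a, a \in s -> atom a,
    \prod_(a <- s) a = \prod_(a <- t) a & size t <= size s].
  by apply: leq_trans szs (HN _ _); split=> //; rewrite ps.
elim: t {c N HN tc} t1 => [|a t IH] t1; first by exists [::].
have [s [sA ps szs]] := IH (fun b bt => t1 b (mem_behead (s := a :: t) bt)).
have [sa saA psa] := genA a; exists (sa ++ s); split.
- by move=> b; rewrite mem_cat => /orP[/saA|/sA].
- by rewrite big_cat big_cons /= psa ps.
have : sa != [::].
  by apply/eqP => e; apply: (t1 a (mem_head _ _)); rewrite -psa e big_nil.
case: sa {saA psa} => // b sa _.
by rewrite size_cat /= addSn ltnS (leq_trans szs) // leq_addl.
Qed.

(** Otherwise the powers of [a * b] would write 1 with arbitrarily many nontrivial factors. *)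
Lemma mulM_eq1 (a b : M) : a * b = 1 -> a = 1.
Proof.
move=> ab; apply: contrapT => a1.
have b1 : b <> 1 by move=> b1; apply: a1; rewrite b1 mulg1 in ab.
have [N /(_ (flatten (nseq N.+1 [:: a; b])))] := chain_bound 1.
rewrite size_flatten /shape map_nseq sumn_nseq => H.
suff : size [:: a; b] * N.+1 <= N by rewrite /=; lia.
apply: H => [c|].
  elim: N.+1 => [//|k IH] /=; rewrite !in_cons => /or3P[/eqP ->|/eqP ->|] //.
elim: N.+1 => [|k IH] /=; first by rewrite big_nil.
by rewrite !big_cons IH mulg1.
Qed.

Lemma leG_anti g h : g <<= h -> h <<= g -> g = h.
Proof.
case=> c <- [c' e]; suff -> : c = 1 by rewrite iota1 mulg1.
apply: (mulM_eq1 (b := c')); apply: iota_inj; rewrite iotaM iota1.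
by apply: (mulgI g); rewrite mulgA e mulg1.
Qed.

Lemma Delta_neq1 : D <> 1.
Proof.
move=> D1; case: nontrivial => a; apply; apply: iota_inj; rewrite iota1.
have [t ->] := generated a; apply: big1_seq => i _.
by have [i1 iD] := simple_dvd i; apply: leG_anti; rewrite // -D1.
Qed.

Lemma leG_Dz_inv r s : Dz r <<= Dz s -> (r <= s)%R.
Proof.
move=> rs; case: (boolP (r <= s)%R) => // sr; case: Delta_neq1.
have e : Dz r = Dz s by apply: leG_anti => //; apply: leG_Dz; lia.
have : Dz (r - s)%R = 1 by rewrite zpowD zpowN e mulgV.
have -> : (r - s = Posz (`|r - s|%N.-1) + 1)%R by lia.
rewrite zpowS => e1; apply: leG_anti (ge1_iota _).
rewrite -[X in _ <<= X]e1 -[X in X <<= _]mul1g.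
by apply: (@leG_mulDr _ _ 1); apply: (@leG_Dz 0).
Qed.

(** * Evaluation of words and the resulting bounds by powers of Delta *)

Lemma word_val_nil : word_val iota d [::] = 1.
Proof. exact: big_nil. Qed.

Lemma word_val_cons l (w : word n) :
  word_val iota d (l :: w) = letter_val iota d l * word_val iota d w.
Proof. exact: big_cons. Qed.

Lemma word_val_cat (w1 w2 : word n) :
  word_val iota d (w1 ++ w2) = word_val iota d w1 * word_val iota d w2.
Proof. exact: big_cat. Qed.

Lemma word_val_winv (w : word n) : word_val iota d (winv w) = (word_val iota d w)^-1.
Proof.
elim: w => [|[i b] w IH]; first by rewrite word_val_nil invg1.
rewrite word_val_cons invgM -IH /winv map_cons rev_cons -cats1 word_val_cat.
congr (_ * _); rewrite word_val_cons word_val_nil mulg1 /letter_val /=.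
by case: b; rewrite ?invgK.
Qed.

Lemma word_val_wpow (w : word n) k : word_val iota d (wpow w k) = word_val iota d w ^+ k.
Proof.
elim: k => [|k IH]; first exact: word_val_nil.
by rewrite /wpow iterS word_val_cat IH expgS.
Qed.

Lemma size_wpow (w : word n) k : size (wpow w k) = (size w * k)%N.
Proof. by elim: k => [|k IH]; rewrite ?muln0 // /wpow iterS size_cat IH mulnS. Qed.

Lemma word_val_surj g : exists w : word n, word_val iota d w = g.
Proof.
have surjM a : exists w : word n, word_val iota d w = iota a.
  have [t ->] := generated a; exists [seq (i, false) | i <- t].
  by rewrite /word_val big_map.
have [a [b ->]] := fractions_surj GF g.
have [wa <-] := surjM a; have [wb <-] := surjM b.
by exists (wa ++ winv wb); rewrite word_val_cat word_val_winv.
Qed.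

Lemma word_val_bound (w : word n) :
  Dz (- (size w)%:Z)%R <<= word_val iota d w /\ word_val iota d w <<= Dz (size w).
Proof.
elim: w => [|[i b] w [IHl IHu]]; first by rewrite word_val_nil; split; exact: leG_refl.
rewrite word_val_cons.
suff [lo up] : Dz (-1)%R <<= letter_val iota d (i, b) /\ letter_val iota d (i, b) <<= Dz 1.
  split.
    rewrite [size _]/=; have -> : (- (size w).+1%:Z = - 1 + - (size w)%:Z)%R by lia.
    exact: leG_D_mul.
  exact: leG_mul_D up IHu.
have [i1 iD] := simple_dvd i.
have m1 : Dz (-1)%R <<= 1 by apply: (@leG_Dz _ 0).
have p1 : 1 <<= Dz 1 by apply: (@leG_Dz 0).
rewrite /letter_val; case: b => /=; last by split=> //; apply: leG_trans i1.
split; first exact: (leG_invD (iota (d i)) (-1)%R).2.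
by apply: leG_trans p1; apply/leG_inv1; rewrite invgK.
Qed.

Lemma D_bounds g : exists k : nat, Dz (- k%:Z)%R <<= g /\ g <<= Dz k.
Proof. by have [w <-] := word_val_surj g; exists (size w); exact: word_val_bound. Qed.

(** * Greatest lower bounds in the group *)

Definition is_glb (I : Type) (u : I -> G) x : Prop :=
  (forall i, x <<= u i) /\ forall w, (forall i, w <<= u i) -> w <<= x.

Lemma glb_unique (I : Type) (u : I -> G) x y : is_glb u x -> is_glb u y -> x = y.
Proof. by move=> [xu xg] [yu yg]; apply: leG_anti; [exact: yg | exact: xg]. Qed.

Lemma glb_mull (I : Type) (u : I -> G) x g :
  is_glb u x -> is_glb (fun i => g * u i) (g * x).
Proof.
move=> [xu xg]; split=> [i|w wu]; first exact: leG_mull.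
by rewrite -[w](mulVKg g); apply/leG_mul2l/xg => i; apply/(leG_mul2l g); rewrite mulVKg.
Qed.

Lemma glb_mulDr (I : Type) (u : I -> G) x r :
  is_glb u x -> is_glb (fun i => u i * Dz r) (x * Dz r).
Proof.
move=> [xu xg]; split=> [i|w wu]; first exact: leG_mulDr.
rewrite -[w](mulgVK (Dz r)); apply/leG_mul2Dr/xg => i.
by apply/(leG_mul2Dr _ _ r); rewrite mulgVK.
Qed.

(** Above a common lower bound v the order is a translate of that of the monoid, where meets exist.
    A smaller base point u yields a meet that is compared with the one obtained from v, so it bounds
    also the elements not above v. *)
Lemma meet_exists g h : exists x,
  [/\ x <<= g, x <<= h & forall w, w <<= g -> w <<= h -> w <<= x].
Proof.
have meet_above v : v <<= g -> v <<= h -> exists x,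
    [/\ x <<= g, x <<= h & forall w, v <<= w -> w <<= g -> w <<= h -> w <<= x].
  move=> [a <-] [b <-].
  have [[m [[a' ma] [b' mb] mg]] _] := garside_latticeL GM a b.
  exists (v * iota m); split.
  - by exists a'; rewrite -ma iotaM mulgA.
  - by exists b'; rewrite -mb iotaM mulgA.
  move=> w [c <-] [e ea] [f fb]; rewrite -!mulgA -!iotaM in ea fb.
  have [k <-] : leL c m.
    by apply: mg; [exists e | exists f]; apply: iota_inj; exact: (mulgI v).
  by rewrite iotaM mulgA; exact: le_iota.
have lower v w : exists u, u <<= v /\ u <<= w.
  have [[k [kv _]] [l [lw _]]] := (D_bounds v, D_bounds w).
  exists (Dz (- (k + l)%:Z)%R).
  by split; [apply: leG_trans kv | apply: leG_trans lw]; apply: leG_Dz; lia.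
have [v [vg vh]] := lower g h.
have [x [xg xh xm]] := meet_above v vg vh; exists x; split=> // w wg wh.
have [u [uv uw]] := lower v w.
have [x' [x'g x'h x'm]] := meet_above u (leG_trans uv vg) (leG_trans uv vh).
apply: (@leG_trans x'); first exact: x'm.
by apply: xm => //; exact: x'm.
Qed.

(** A strictly descending chain between [z0] and [y] factors y^-1 z0 into nontrivial elements, so
    [chain_bound] limits its length. *)
Lemma minimal_element (Q : G -> Prop) y z0 : Q z0 -> (forall z, Q z -> y <<= z) ->
  exists2 z, Q z & forall z', Q z' -> z' <<= z -> z' = z.
Proof.
move=> Qz0 Qy.
have [c0 ec0] := Qy _ Qz0; have [N HN] := chain_bound c0.
elim: N z0 c0 Qz0 ec0 HN => [|N IH] z c Qz ec HN.
  exists z => // z' Qz' [t et]; have [t1|t1] := eqVneq t 1; first by rewrite -et t1 iota1 mulg1.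
  have [c' ec'] := Qy _ Qz'.
  have cc : c = c' * t.
    by apply: iota_inj; apply: (mulgI y); rewrite ec -et -ec' iotaM mulgA.
  have [e|c'1] := eqVneq c' 1.
    suff : size [:: t] <= 0 by [].
    apply: HN => [a|]; first by rewrite inE => /eqP ->; apply/eqP.
    by rewrite big_seq1 cc e mul1g.
  suff : size [:: c'; t] <= 0 by [].
  apply: HN => [a|]; first by rewrite !inE => /orP[] /eqP ->; apply/eqP.
  by rewrite !big_cons big_nil mulg1.
have [[z' [Qz' zz' nz]]|Hmin] := pselect (exists z', [/\ Q z', z' <<= z & z' <> z]); last first.
  exists z => // z' Qz' zz'; apply: contrapT => ne; apply: Hmin.
  by exists z'.
have [c' ec'] := Qy _ Qz'; apply: (IH z' c') => // s s1 ps.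
have [t et] := zz'.
have := HN (rcons s t); rewrite size_rcons ltnS; apply.
  move=> a; rewrite mem_rcons inE => /orP[/eqP -> t1|/s1 //].
  by apply: nz; rewrite -et t1 iota1 mulg1.
rewrite -cats1 big_cat big_seq1 /= ps; apply: iota_inj; apply: (mulgI y).
by rewrite ec -et -ec' iotaM mulgA.
Qed.

(* A minimal z among the elements above all lower bounds of u is below each   *)
(* u i, because z /\ u i is again such an element.                            *)
Lemma glb_exists (I : Type) (i0 : I) (u : I -> G) y :
  (forall i, y <<= u i) -> exists x, is_glb u x.
Proof.
move=> yu; pose Q z := forall w, (forall i, w <<= u i) -> w <<= z.
have [z Qz zmin] : exists2 z, Q z & forall z', Q z' -> z' <<= z -> z' = z.
  by apply: (@minimal_element Q y (u i0)) => [w|z]; apply.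
exists z; split=> // i; have [m [mz mu mg]] := meet_exists z (u i).
rewrite -(zmin m _ mz) // => w wu; apply: mg => //; exact: Qz.
Qed.

(** * Super summit elements and powers *)

(** Turns a bound on a conjugate into an inequality for the conjugator that is preserved by meets;
    [conjD_le] does the same for upper bounds. *)
Lemma conjD_ge g x r : Dz r <<= g ^ x <-> x <<= g * x * Dz (- r)%R.
Proof.
rewrite /conjg -(leG_mul2l x) mulVKg -(leG_mul2Dr _ _ (- r)%R).
by rewrite -[x * _ * _]mulgA -zpowD GRing.addrN mulg1.
Qed.

Lemma conjD_le g x r : g ^ x <<= Dz r <-> g * x * Dz (- r)%R <<= x.
Proof.
rewrite /conjg -(leG_mul2l x) mulVKg -(leG_mul2Dr _ _ (- r)%R).
by rewrite -[x * _ * _]mulgA -zpowD GRing.addrN mulg1.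
Qed.

Section Tower.
Variables (g : G) (m : nat) (s : int) (y0 : G).
Hypothesis m_gt0 : 0 < m.
Hypothesis root : Dz s <<= (g ^+ m) ^ y0.

Definition slope (c : int) (i : nat) : int := ((i%:Z * s + c) %/ m%:Z)%Z.

Definition twisted (c : int) (i : nat) : G := g ^+ i * Dz (- slope c i)%R.

Lemma slopeP r c i : (r <= slope c i)%R = (r * m%:Z <= i%:Z * s + c)%R.
Proof. by rewrite /slope lez_divRL. Qed.

Lemma slope_mul c i : (slope c i * m%:Z <= i%:Z * s + c)%R.
Proof. by rewrite -slopeP. Qed.

Lemma slopeD c i j : (slope 0 i + slope c j <= slope c (i + j))%R.
Proof.
rewrite slopeP GRing.mulrDl PoszD GRing.mulrDl.
by have := slope_mul 0 i; have := slope_mul c j; lia.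
Qed.

Lemma slope_shift c i (k : int) : slope (c + k * m%:Z)%R i = (slope c i + k)%R.
Proof.
rewrite /slope GRing.addrA [(_ + k * _)%R]GRing.addrC divzMDl.
  exact: GRing.addrC.
by case: m m_gt0.
Qed.

Lemma slope_mono c c' i : (c <= c')%R -> (slope c i <= slope c' i)%R.
Proof. by move=> cc; rewrite slopeP; have := slope_mul c i; lia. Qed.

Lemma slopeS c i : slope c i.+1 = slope (c + s)%R i.
Proof. by rewrite /slope; congr (_ %/ _)%Z; lia. Qed.

Lemma twisted_bounded c : exists y, forall i, y <<= twisted c i.
Proof.
have [a [ya _]] := D_bounds y0; have [b [yb _]] := D_bounds y0^-1.
have [l [gl _]] := D_bounds g.
have slope_bound j : j < m -> (slope c j <= `|s| + `|c|)%R.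
  move=> jm; suff : (slope c j < `|s| + `|c| + 1)%R by lia.
  rewrite /slope ltz_divLR //.
  have -> : ((`|s| + `|c| + 1) * m%:Z = `|s| * m%:Z + `|c| * m%:Z + m%:Z)%R.
    by rewrite !GRing.mulrDl GRing.mul1r.
  nia.
(* With i = q m + j, the growth Delta^(s q) of g^(q m) cancels against the slope. What remains is
   [a] and [b] for the conjugator [y0] and its inverse, [l * m] for g^j, and [|s| + |c|] for the
   slope at j. *)
pose K : int := (a%:Z + b%:Z + l%:Z * m%:Z + `|s| + `|c|)%R.
exists (Dz (- K)%R) => i; rewrite /twisted.
rewrite (divn_eq i m); set q := i %/ m; set j := i %% m.
have jm : j < m by rewrite ltn_mod.
have -> : slope c (q * m + j)%N = (s * q%:Z + slope c j)%R.
  rewrite /slope; have -> : ((q * m + j)%N%:Z * s + c = s * q%:Z * m%:Z + (j%:Z * s + c))%R by lia.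
  by rewrite divzMDl //; lia.
have gq : Dz (- (a%:Z) + s * q%:Z + - (b%:Z))%R <<= g ^+ (q * m).
  have -> : g ^+ (q * m) = y0 * ((g ^+ m) ^ y0) ^+ q * y0^-1.
    by rewrite -conjXg -expgnA mulnC /conjg !mulgA mulgV mul1g mulgK.
  by apply: leG_D_mul yb; apply: leG_D_mul ya _; exact: leG_DX.
have gj : Dz (- (l%:Z) * j%:Z)%R <<= g ^+ j by exact: leG_DX.
have := leG_mulDr (- (s * q%:Z + slope c j))%R (leG_D_mul gq gj).
rewrite -expgnDr -zpowD; apply: leG_trans; apply: leG_Dz.
have := slope_bound j jm; rewrite /K; nia.
Qed.

Lemma tower_exists : exists y : int -> G, forall c, is_glb (twisted c) (y c).
Proof.
suff /choice[y Hy] : forall c, exists x, is_glb (twisted c) x by exists y.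
by move=> c; have [y yt] := twisted_bounded c; exact: (glb_exists 0) yt.
Qed.

Variable y : int -> G.
Hypothesis y_glb : forall c, is_glb (twisted c) (y c).

Lemma tower_mono c c' : (c <= c')%R -> y c' <<= y c.
Proof.
move=> cc; apply: (y_glb c).2 => i; apply: leG_trans ((y_glb c').1 i) _.
apply: leG_mull; apply: leG_Dz; have := slope_mono i cc; lia.
Qed.

Lemma tower_shift c (k : int) : y (c + k * m%:Z)%R = y c * Dz (- k)%R.
Proof.
apply: glb_unique (y_glb _) _.
have -> : twisted (c + k * m%:Z)%R = fun i => twisted c i * Dz (- k)%R.
  apply/funext => i; rewrite /twisted -mulgA -zpowD; congr (_ * Dz _).
  by rewrite slope_shift GRing.opprD.
exact: glb_mulDr.
Qed.

Lemma tower_step c : y c <<= g * y (c + s)%R.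
Proof.
apply: (glb_mull g (y_glb (c + s)%R)).2 => i.
by rewrite /twisted mulgA -expgS -slopeS; exact: (y_glb c).1.
Qed.

(** By superadditivity of the slope, term k + i of the meet [y 0] lies below term i of g^k (y 0)
    Delta^(-slope 0 k). *)
Lemma tower_inf k : Dz (slope 0 k) <<= (g ^+ k) ^ y 0.
Proof.
apply/conjD_ge.
apply: (glb_mulDr _ (glb_mull (g ^+ k) (y_glb 0))).2 => i.
apply: leG_trans ((y_glb 0).1 (k + i)) _.
rewrite /twisted expgnDr -!mulgA -zpowD; do 2!apply: leG_mull.
by apply: leG_Dz; have := slopeD 0 k i; lia.
Qed.

(** Conjugating g^k by a term g^i Delta^j amounts to conjugating it by Delta^j, which keeps its
    bounds by powers of Delta; such bounds pass to the meet of the terms. The same holds for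
    [tower_upper]. *)
Lemma tower_lower k r : Dz r <<= g ^+ k -> Dz r <<= (g ^+ k) ^ y 0.
Proof.
move=> rg; apply/conjD_ge.
apply: (glb_mulDr _ (glb_mull (g ^+ k) (y_glb 0))).2 => i.
apply: leG_trans ((y_glb 0).1 i) _.
rewrite /twisted mulgA -expgnDr addnC expgnDr -!mulgA -zpowD GRing.addrC zpowD.
apply: leG_mull; rewrite mulgA -[X in X <<= _]mul1g; apply: leG_mulDr.
by rewrite -(leG_mul2Dr _ _ r) mul1g -mulgA -zpowD GRing.addNr mulg1.
Qed.

Lemma tower_upper k r : g ^+ k <<= Dz r -> (g ^+ k) ^ y 0 <<= Dz r.
Proof.
move=> gr; apply/conjD_le; apply: (y_glb 0).2 => i.
apply: leG_trans ((glb_mulDr _ (glb_mull (g ^+ k) (y_glb 0))).1 i) _.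
rewrite /twisted mulgA -expgnDr addnC expgnDr -!mulgA -zpowD GRing.addrC zpowD.
apply: leG_mull; rewrite mulgA -[X in _ <<= X]mul1g; apply: leG_mulDr.
by rewrite -(leG_mul2Dr _ _ r) mul1g -mulgA -zpowD GRing.addNr mulg1.
Qed.

End Tower.

Lemma stabilize g m s y0 : 0 < m -> Dz s <<= (g ^+ m) ^ y0 ->
  exists x, [/\ forall k, Dz (slope m s 0 k) <<= (g ^+ k) ^ x,
    forall k r, Dz r <<= g ^+ k -> Dz r <<= (g ^+ k) ^ x &
    forall k r, g ^+ k <<= Dz r -> (g ^+ k) ^ x <<= Dz r].
Proof.
move=> m_gt0 root; have [y y_glb] := tower_exists m_gt0 root.
exists (y 0%R); split=> k.
- exact: (tower_inf m_gt0 y_glb k).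
- by move=> r; apply: (tower_lower y_glb).
- by move=> r; apply: (tower_upper y_glb).
Qed.

Lemma int_max (P : int -> Prop) a b : P a -> (forall r, P r -> (r <= b)%R) ->
  exists r, is_max P r.
Proof.
move=> Pa Pb.
have exP : exists k : nat, `[< P (a + k%:Z)%R >] by exists 0; rewrite GRing.addr0; apply/asboolP.
have ubP (k : nat) : `[< P (a + k%:Z)%R >] -> k <= `|b - a|%N by move/asboolP/Pb; lia.
have [k /asboolP Pk kmax] := ex_maxnP exP ubP.
exists (a + k%:Z)%R; split=> // r Pr.
have [|ar] := boolP (r <= a)%R; first by lia.
have := kmax `|r - a|%N; have -> : (a + `|r - a|%N%:Z = r)%R by lia.
by move/(_ (asboolT Pr)); lia.
Qed.

Lemma between_shift_simple g z : g <<= z -> z <<= g * D -> exists i, z = g * iota (d i).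
Proof.
case=> a <- [b]; rewrite -mulgA -iotaM => /mulgI/iota_inj ab.
by have [|i <-] := (Hd.2 a).1; [exists b | exists i].
Qed.

(* The chain of the y c modulo Delta has at most n members, so the walk       *)
(* c -> top (c + s), where top c is the last index with the same y, returns    *)
(* modulo m to an earlier index after q <= n steps.                            *)
Lemma small_root g m s y0 : 0 < m -> Dz s <<= (g ^+ m) ^ y0 ->
  exists q p x, [/\ 0 < q <= n, (q%:Z * s <= p * m%:Z)%R & Dz p <<= (g ^+ q) ^ x].
Proof.
move=> m_gt0 root; have [y y_glb] := tower_exists m_gt0 root.
have shift := tower_shift m_gt0 y_glb; have mono := tower_mono m_gt0 y_glb.
(* A last index with the value [y c] exists: from [c + m] on, [y] is at most y(c) Delta^-1. *)
have /choice[top topP] : forall c, exists c', is_max (fun c' => y c' = y c) c'.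
  move=> c; apply: (@int_max _ c (c + m%:Z)%R) => // c' e.
  have [//|/negP lt] := boolP (c' <= c + m%:Z)%R.
  have /mono : (c + 1 * m%:Z <= c')%R by lia.
  rewrite shift e -[X in X <<= _]mulg1 leG_mul2l => /(leG_Dz_inv (r := 0)).
  by [].
pose cs := fix cs k := if k is k'.+1 then top (cs k' + s)%R else top 0%R.
have cs_top k c : y c = y (cs k) -> (c <= cs k)%R.
  by case: k => [|k] /=; set c0 := (X in top X); have [-> H] := topP c0; exact: H.
have csS k : cs k.+1 = top (cs k + s)%R by [].
clearbody cs.
have cs_step k : y (cs k) <<= g * y (cs k.+1).
  have [e _] := topP (cs k + s)%R; rewrite csS e.
  exact: (tower_step m_gt0 y_glb).
have cs_incr k j : (cs k + j%:Z * s <= cs (k + j)%N)%R.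
  elim: j => [|j IH]; first by rewrite addn0; lia.
  have [_ /(_ _ erefl)] := topP (cs (k + j)%N + s)%R.
  by rewrite addnS csS; lia.
have cs_iter k j : y (cs k) <<= g ^+ j * y (cs (k + j)).
  elim: j => [|j IH]; first by rewrite addn0 mul1g; exact: leG_refl.
  apply: leG_trans IH _; rewrite expgSr -mulgA addnS.
  by apply: leG_mull; exact: cs_step.
pose mu k := (cs k %/ m%:Z)%Z; pose rho k := (cs k %% m%:Z)%Z.
have cs_div k : cs k = (rho k + mu k * m%:Z)%R by rewrite GRing.addrC -divz_eq.
(* Residues lie in [0, m), so [y (rho k)] lies between [y m] and [y 0], which is [y m * D]; their
   difference is a simple element, of which there are only [n]. *)
have /choice[f fP] : forall k, exists i, y (rho k) = y (Posz m) * iota (d i).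
  move=> k; have mZ : (m%:Z = 0 + 1 * m%:Z)%R by lia.
  apply: between_shift_simple.
    by apply: mono; have := @ltz_pmod (cs k) (Posz m); rewrite /rho; lia.
  have -> : y (Posz m) * D = y 0%R by rewrite mZ shift -mulgA -(zpowD _ _ 1) mulg1.
  by apply: mono; apply: modz_ge0; case: (m) m_gt0.
have [i [j [ij fij]]] : exists i j, i < j <= n /\ f i = f j.
  have /injectivePn[i [j ij e]] : ~~ injectiveb (fun i : 'I_n.+1 => f i).
    apply/injectiveP => /leq_card; rewrite !card_ord; lia.
  have := ltn_ord i; have := ltn_ord j.
  case: (ltngtP (i : nat) j) ij => [lt _|lt _|/val_inj ->]; last by rewrite eqxx.
    by exists i, j; split=> //; lia.
  by exists j, i; split=> //; lia.
pose p := (mu j - mu i)%R; pose q := (j - i)%N.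
have yij : y (cs j) = y (cs i) * Dz (- p)%R.
  rewrite cs_div shift [in RHS]cs_div shift fP -fij -fP -mulgA -zpowD.
  by congr (_ * Dz _); rewrite /p; lia.
have jE : j = i + q by rewrite /q; lia.
exists q, p, (y (cs i)); split; first by rewrite /q; lia.
  (* [cs i] is the last index with its value of [y], and [cs j - p * m] has that same value. As [cs]
     grows by at least [s] per step, this gives q s <= p m. *)
  have : (cs j - p * m%:Z <= cs i)%R.
    apply: cs_top; have -> : (cs j - p * m%:Z = cs j + - p * m%:Z)%R by lia.
    by rewrite shift yij -mulgA -zpowD GRing.addrN mulg1.
  by have := cs_incr i q; rewrite -jE; lia.
by apply/conjD_ge; rewrite -mulgA -yij jE.
Qed.

(** * Elements that are optimal for all powers at once *)

Definition inf_dominates (g h : G) : Prop := forall x r, Dz r <<= g ^ x -> Dz r <<= h.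

(** [small_root] provides q <= n whose slope p/q is at least that of the given exponent. With
    exponent kq + j, the factor (h^q)^k contributes pk, and h^j contributes at least floor(jp/q) by
    [stabilize]. *)
Lemma inf_dominates_powers g h :
  (forall k, 0 < k <= n -> inf_dominates (g ^+ k) (h ^+ k)) ->
  forall k, inf_dominates (g ^+ k) (h ^+ k).
Proof.
move=> small [|m] x s; first by rewrite !expg0 conj1g.
move=> /(small_root (ltn0Sn m)) [q [p [x' [/andP[q_gt0 qn] pq root]]]].
have [x'' [low _ _]] := stabilize q_gt0 root.
set k := m.+1 %/ q; set j := m.+1 %% q.
have mE : m.+1 = (k * q + j)%N by exact: divn_eq.
have hq : Dz p <<= h ^+ q by apply: (small q); [rewrite q_gt0 | exact: root].
have hj : Dz (slope q p 0 j) <<= h ^+ j.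
  have := low j; have : j < q by rewrite ltn_mod.
  case: j {mE} => [|j] lt; first by rewrite !expg0 conj1g.
  by apply: small; lia.
have -> : h ^+ m.+1 = (h ^+ q) ^+ k * h ^+ j by rewrite mE expgnDr mulnC expgnA.
apply: leG_trans (leG_D_mul (leG_DX k hq) hj); apply: leG_Dz.
suff : (s - p * k%:Z <= slope q p 0 j)%R by lia.
by rewrite slopeP //; nia.
Qed.

(** In the k-th powers the gap r - s is multiplied by k, while the conjugator costs at most a + b,
    which is less than the chosen k. *)
Lemma inf_conj_le g x r s : Dz r <<= g ^ x -> g <<= Dz s -> (r <= s)%R.
Proof.
move=> rg gs; have [a [xa _]] := D_bounds x; have [b [xb _]] := D_bounds x^-1.
pose k := (a + b).+1.
have : Dz (- a%:Z + r * k%:Z + - b%:Z)%R <<= g ^+ k.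
  have -> : g ^+ k = x * (g ^ x) ^+ k * x^-1.
    by rewrite -conjXg /conjg !mulgA mulgV mul1g mulgK.
  by apply: leG_D_mul xb; apply: leG_D_mul xa _; exact: leG_DX.
move/leG_trans/(_ (leG_XD k gs))/leG_Dz_inv; rewrite /k; nia.
Qed.

(** Every k <= n divides n!, so a conjugate of g^k above Delta^r gives one of g^(n!) above Delta^(r
    n!/k). Hence stabilizing at the maximal slope for n! is optimal for all k <= n, and then for all
    k. *)
Lemma inf_optimal_conj g : exists x,
  (forall k, inf_dominates (g ^+ k) ((g ^ x) ^+ k)) /\
  (forall k r, g ^+ k <<= Dz r -> (g ^ x) ^+ k <<= Dz r).
Proof.
have [a [ga gb]] := D_bounds (g ^+ n`!).
have [s [[y root] smax]] : exists s, is_max (fun r => exists y, Dz r <<= (g ^+ n`!) ^ y) s.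
  apply: (@int_max _ (- a%:Z)%R a); first by exists 1; rewrite conjg1.
  by move=> r [y ry]; exact: inf_conj_le ry gb.
have [x [low _ up]] := stabilize (fact_gt0 n) root.
exists x; split; last by move=> k r; rewrite -conjXg; exact: up.
apply: inf_dominates_powers => k kn z r rz; rewrite -conjXg.
apply: leG_trans (low k); apply: leG_Dz; rewrite slopeP ?fact_gt0 //.
have /dvdnP[t tk] : k %| n`! by apply: dvdn_fact.
have : (r * t%:Z <= s)%R.
  by apply: smax; exists z; rewrite tk mulnC expgnA conjXg; exact: leG_DX.
rewrite tk; nia.
Qed.

Lemma inf_dominates_conj g x h : inf_dominates (g ^ x) h -> inf_dominates g h.
Proof. by move=> H y r ry; apply: (H (x^-1 * y)); rewrite conjgM conjgK. Qed.

(** The second conjugation optimizes inf and preserves upper bounds on powers, so it keeps the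
    optimum for the inverse reached by the first. *)
Lemma stable_exists g : exists x, forall k,
  inf_dominates (g ^+ k) ((g ^ x) ^+ k) /\
  inf_dominates (g^-1 ^+ k) ((g ^ x)^-1 ^+ k).
Proof.
have [x [opt _]] := inf_optimal_conj g^-1.
have [y [opt' up]] := inf_optimal_conj (g ^ x).
exists (x * y) => k; rewrite conjgM; split.
  by apply: (inf_dominates_conj (x := x)); rewrite conjXg; exact: opt'.
move=> z r /opt; rewrite conjVg !expVgn => /leG_invD/up H.
by apply/leG_invD.
Qed.

(** * Searching the conjugacy class *)

Definition within (l : nat) (g : G) : Prop := Dz (- l%:Z)%R <<= g /\ g <<= Dz l.

Definition letter_step : rel G :=
  fun a b => [exists l : letter n, b == a ^ letter_val iota d l].

Definition reach l g h : Prop := exists p,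
  [/\ path letter_step g p, last g p = h & forall a, a \in p -> within l a].

Lemma letter_path_word g p : path letter_step g p ->
  exists2 t : word n, size t = size p & last g p = g ^ word_val iota d t.
Proof.
elim: p g => [|b p IH] g /=; first by exists [::] => //; rewrite word_val_nil conjg1.
case/andP=> /existsP[e /eqP ->] /IH[t ts ->]; exists (e :: t); first by rewrite /= ts.
by rewrite word_val_cons conjgM.
Qed.

Lemma reach_refl l g : reach l g g.
Proof. by exists [::]. Qed.

Lemma reach_trans l g h u : reach l g h -> reach l h u -> reach l g u.
Proof.
move=> [p [gp ep bp]] [q [hq eq bq]]; exists (p ++ q).
rewrite cat_path last_cat gp ep; split=> // a.
by rewrite mem_cat => /orP[/bp|/bq].
Qed.

Lemma reach_letter l g (b : letter n) : within l (g ^ letter_val iota d b) ->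
  reach l g (g ^ letter_val iota d b).
Proof.
move=> H; exists [:: g ^ letter_val iota d b]; split=> //=.
  by rewrite andbT; apply/existsP; exists b.
by move=> a; rewrite inE => /eqP ->.
Qed.

Lemma within_conjD l g r : within l g -> within l (g ^ Dz r).
Proof.
have DzC s : Dz r * Dz s = Dz s * Dz r by rewrite -!zpowD GRing.addrC.
case=> lo up; split; rewrite /conjg -(leG_mul2l (Dz r)) mulVKg DzC; exact: leG_mulDr.
Qed.

Lemma within_meet l g x y z : is_glb (fun b : bool => if b then x else y) z ->
  within l (g ^ x) -> within l (g ^ y) -> within l (g ^ z).
Proof.
move=> Hz [/conjD_ge xlo /conjD_le xup] [/conjD_ge ylo /conjD_le yup].
have zx := Hz.1 true; have zy := Hz.1 false.
split; [apply/conjD_ge | apply/conjD_le].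
  apply: (glb_mulDr _ (glb_mull g Hz)).2 => -[]; first exact: leG_trans zx xlo.
  exact: leG_trans zy ylo.
apply: Hz.2 => -[].
  by apply: leG_trans xup; apply: leG_mulDr; exact: leG_mull.
by apply: leG_trans yup; apply: leG_mulDr; exact: leG_mull.
Qed.

Lemma ge1_prod (t : seq 'I_n) : 1 <<= \prod_(i <- t) iota (d i).
Proof.
elim: t => [|i t IH]; first by rewrite big_nil; exact: leG_refl.
by rewrite big_cons; apply: leG_trans (ge1_iota _) (leG_ge1_mul _ IH).
Qed.

Lemma meetD_eq1 (c : M) :
  (forall w, w <<= iota c -> w <<= D -> w <<= 1) -> c = 1.
Proof.
move=> c1; apply: iota_inj; rewrite iota1; have [t ct] := generated c.
rewrite ct in c1 *; elim: t {ct} c1 => [|j t IH] c1; first by rewrite big_nil.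
have dj1 : iota (d j) = 1.
  have [j1 jD] := simple_dvd j; apply: leG_anti => //; apply: c1 => //.
  by rewrite big_cons; exact: leG_ge1_mul (ge1_prod _).
by rewrite big_cons dj1 mul1g; apply: IH; rewrite big_cons dj1 mul1g in c1.
Qed.

Lemma first_simple (c : M) : c <> 1 -> exists i x,
  [/\ is_glb (fun b : bool => if b then iota c else D) (iota (d i)),
      d i <> 1 & c = d i * x].
Proof.
move=> c1; have [z [zc zD zm]] := meet_exists (iota c) D.
have [i zi] : exists i, z = 1 * iota (d i).
  by apply: between_shift_simple; rewrite ?mul1g //; apply: zm; exact: ge1_iota.
rewrite mul1g in zi; have [x xc] := zc; exists i, x; split.
- by rewrite -zi; split=> [[]|w wu] //; apply: zm; [exact: (wu true) | exact: (wu false)].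
- by move=> di1; apply: c1; apply: meetD_eq1; rewrite -iota1 -di1 -zi.
- by apply: iota_inj; rewrite iotaM -zi xc.
Qed.

(** The meet of [c] and Delta is a simple first step. It stays in the interval by [within_meet], as
    conjugation by [c] and by Delta both do, and it shortens [c]. *)
Lemma reach_positive l g (c : M) :
  within l g -> within l (g ^ iota c) -> reach l g (g ^ iota c).
Proof.
have [N] := chain_bound c.
elim: N c g => [|N IH] c g HN gl cl; have [->|/eqP c1] := eqVneq c 1.
- by rewrite iota1 conjg1; exact: reach_refl.
- suff : size [:: c] <= 0 by [].
  by apply: HN => [a|]; rewrite ?big_seq1 // inE => /eqP ->.
- by rewrite iota1 conjg1; exact: reach_refl.
have [i [x [Hglb di1 cE]]] := first_simple c1.
have il : within l (g ^ iota (d i)).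
  by apply: within_meet Hglb cl _; exact: (@within_conjD _ _ 1).
apply: reach_trans (reach_letter (b := (i, false)) il) _.
rewrite /letter_val /= cE iotaM conjgM; apply: IH => //; last first.
  by rewrite -conjgM -iotaM -cE.
move=> t t1 tx; have := HN (d i :: t); rewrite ltnS; apply.
  by move=> a; rewrite inE => /orP[/eqP ->|/t1].
by rewrite big_cons tx cE.
Qed.

(** Multiplying the conjugator by a power Delta^k makes it positive; k conjugations by Delta^-1,
    which preserve the interval, then lead back to [h]. *)
Lemma reach_conj l g h : within l g -> within l h -> conj_class g h -> reach l g h.
Proof.
move=> gl hl [x hx]; have [k [kx _]] := D_bounds x.
have [c xc] : exists c, x * Dz k = iota c.
  by apply: ge1P; rewrite -(leG_mul2Dr _ _ (- k%:Z)%R) mul1g -mulgA -zpowD GRing.addrN mulg1.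
have [iD diD] : exists iD, d iD = Delta by apply/(Hd.2 _); exists 1; rewrite mulg1.
have vD : letter_val iota d (iD, true) = Dz (-1)%R by rewrite /letter_val /= diD.
have back : reach l (h ^ Dz k) h.
  elim: k {kx xc} => [|k IH]; first by rewrite conjg1; exact: reach_refl.
  apply: reach_trans IH.
  have -> : h ^ Dz k = (h ^ Dz k.+1) ^ letter_val iota d (iD, true).
    by rewrite vD [zpow _ _ in RHS]expgSr conjgM conjgK.
  by apply: reach_letter; rewrite vD; do 2!apply: within_conjD.
apply: reach_trans back; rewrite hx -conjgM xc; apply: reach_positive => //.
by rewrite -xc conjgM -hx; exact: within_conjD.
Qed.

(** Greedy splitting by meets with Delta. The simple letters may be 1, which makes the length
    exactly [k]. *)
Lemma ge1_le_Dz z (k : nat) : 1 <<= z -> z <<= Dz k ->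
  exists2 t : word n, size t = k & word_val iota d t = z.
Proof.
elim: k z => [|k IH] z z1 zk.
  by exists [::] => //; rewrite word_val_nil; exact: leG_anti.
have [m [mz mD mm]] := meet_exists z D.
have [i mi] : exists i, m = 1 * iota (d i).
  by apply: between_shift_simple; rewrite ?mul1g //; apply: mm => //; exact: ge1_iota.
rewrite mul1g in mi; have [c mc] := mz.
have [|t tk tc] := IH (iota c) (ge1_iota c).
  rewrite -(leG_mul2l m) mc -(leG_mul2Dr _ _ (- k%:Z)%R) -mulgA -zpowD GRing.addrN mulg1.
  (* The element z Delta^-k lies below both [z] and [D], hence below their meet [m]. *)
  apply: mm.
    by rewrite -[X in _ <<= X]mulg1; apply: leG_mull; apply: (@leG_Dz _ 0); lia.
  apply: leG_trans (leG_mulDr _ zk) _; rewrite -zpowD.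
  have -> : (Posz k.+1 + - k%:Z = 1)%R by lia.
  exact: (leG_refl D).
exists ((i, false) :: t); first by rewrite /= tk.
by rewrite word_val_cons tc /letter_val /= -mi.
Qed.

(** A shortest path visits distinct elements of [Delta^-l, Delta^l], each of which is Delta^-l times
    a word of length 2l. So the number of such words bounds the length of the conjugator. *)
Lemma conjugatesP (w : word n) h : within (size w) h -> conj_class (word_val iota d w) h ->
  exists2 u : word n, u \in conjugates w & word_val iota d u = h.
Proof.
set l := size w; set g := word_val iota d w => hl gh.
have [p [gp <- pl]] := reach_conj (word_val_bound w) hl gh.
set alphabet := enum {: letter n}.
have memE (u : word n) : {subset u <= alphabet} by move=> b _; rewrite mem_enum.
have /shortenP[q gq uq qp] := gp.
have qE : {subset q <= [seq Dz (- l%:Z)%R * word_val iota d t | t <- words_upto alphabet (w ++ w)]}.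
  move=> a /qp/pl[alo aup].
  have [|/=|u ul ua] := @ge1_le_Dz (Dz l * a) (l + l)%N.
  - by rewrite -(leG_mul2l (Dz (- l%:Z)%R)) mulgA -zpowD GRing.addNr mul1g mulg1.
  - have := leG_mull (Dz l) aup; by rewrite -zpowD.
  apply/mapP; exists u; last by rewrite ua mulgA -zpowD GRing.addNr mul1g.
  by apply: mem_words_upto => //; rewrite size_cat ul.
have qsz : size q <= size (words_upto alphabet (w ++ w)).
  by have /andP[_ /uniq_leq_size/(_ qE)] := uq; rewrite size_map.
have [u us ug] := letter_path_word gq.
exists (winv u ++ (w ++ u)); last by rewrite !word_val_cat word_val_winv ug.
by apply: map_f; apply: mem_words_upto => //; rewrite us.
Qed.

Lemma conjugates_conj (w u : word n) : u \in conjugates w ->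
  conj_class (word_val iota d w) (word_val iota d u).
Proof.
case/mapP=> x _ ->; exists (word_val iota d x).
by rewrite !word_val_cat word_val_winv.
Qed.

Lemma within_inv l g : within l g -> within l g^-1.
Proof.
by case=> lo up; split; [apply/leG_invD; rewrite GRing.opprK | apply/leG_inv_le].
Qed.

Lemma inf_dominates_within l g h : within l g ->
  inf_dominates g h -> inf_dominates g^-1 h^-1 -> within l h.
Proof.
move=> gl dom domV; have [lo _] := gl; have [loV _] := within_inv gl; split.
  by apply: (dom 1); rewrite conjg1.
by rewrite -[(l : int)]GRing.opprK; apply/leG_invD; apply: (domV 1); rewrite conjg1.
Qed.

(** * Correctness of the algorithm *)

Section Decision.
Variables (iD i1 : 'I_n) (tau cc : 'I_n -> 'I_n) (pp qq : 'I_n -> 'I_n -> 'I_n).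
Hypothesis d_iD : d iD = Delta.
Hypothesis d_i1 : d i1 = 1.
Hypothesis d_cc : forall i, d (cc i) * d i = Delta.
Hypothesis d_tau : forall i, iota (d (tau i)) = iota (d i) ^ D.
Hypothesis pp_qq : forall a b, d (pp a b) * d a = d (qq a b) * d b.
Hypothesis pp_join : forall a b c, leR (d b) (c * d a) -> leR (d (pp a b)) c.

Notation pr s := (\prod_(i <- s) d i).

(** Pastes the squares [pp_qq] along [y]; the first component of the state is what [a] has become
    after passing [y]. *)
Lemma residue_stepP a y (st := foldr (residue_step pp qq) (a, [::]) y) :
  pr st.2 * d a = d st.1 * pr y /\
  forall c, leR (pr y) (c * d a) -> leR (pr st.2) c.
Proof.
rewrite /st; elim: y {st} => [|b y [IHe IHr]] /=.
  by rewrite !big_nil mul1g mulg1; split=> // c _; exists c; rewrite mulg1.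
move: (foldr _ _ _) IHe IHr => st IHe IHr; rewrite !big_cons; split.
  by rewrite -mulgA IHe !mulgA pp_qq.
move=> c [e ec]; have [|f fc] := IHr c; first by exists (e * d b); rewrite -mulgA.
have : leR (d b) (f * d st.1).
  exists e; apply: (garside_cancelR GM (a := pr y)).
  by rewrite -[RHS]mulgA -IHe mulgA fc -ec mulgA.
by move/pp_join => [k kf]; exists k; rewrite -fc -kf mulgA.
Qed.

Lemma residueP a y c : leR (pr y) (c * d a) <-> leR (pr (residue pp qq a y)) c.
Proof.
have [e r] := residue_stepP a y; split; first exact: r.
by case=> f <-; exists (f * d (foldr (residue_step pp qq) (a, [::]) y).1); rewrite -!mulgA e.
Qed.

Lemma foldr_residueP y s c :
  leR (pr y) (c * pr s) <-> leR (pr (foldr (residue pp qq) y s)) c.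
Proof.
elim: s c => [|a s IH] c; first by rewrite big_nil mulg1.
by rewrite big_cons mulgA IH residueP.
Qed.

Lemma pr_eq1 t : pr t = 1 <-> all (fun i => i == i1) t.
Proof.
elim: t => [|i t IH]; first by rewrite big_nil.
rewrite big_cons /=; split=> [e|/andP[/eqP -> /IH ->]]; last by rewrite d_i1 mulg1.
have di1 := mulM_eq1 e; rewrite di1 mul1g in e.
by apply/andP; split; [apply/eqP/Hd.1; rewrite di1 d_i1 | apply/IH].
Qed.

Lemma iota_pr_tau s : iota (pr (map tau s)) = iota (pr s) ^ D.
Proof.
elim: s => [|i s IH]; first by rewrite !big_nil iota1 conj1g.
by rewrite /= !big_cons !iotaM IH d_tau conjMg.
Qed.

(** An inverse letter a^-1 is Delta^-1 times its complement [cc], and Delta^-1 moves to the right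
    end at the price of applying [tau]. *)
Lemma fractionP (w : word n) : exists k : nat, (fraction iD tau cc w).1 = nseq k iD /\
  word_val iota d w = iota (pr (fraction iD tau cc w).2) * Dz (- k%:Z)%R.
Proof.
elim: w => [|[i b] w [k [ey es]]]; first by exists 0; rewrite word_val_nil /= big_nil iota1 mulg1.
rewrite word_val_cons es /fraction [foldr _ _ _]/= -/(fraction iD tau cc w) /fraction_step.
case: b; rewrite /letter_val /=; last by exists k; rewrite big_cons iotaM mulgA.
exists k.+1; split; first by rewrite ey.
rewrite -[tau _ :: _]/(map tau (cc i :: _)) iota_pr_tau big_cons.
have -> : (iota (d i))^-1 = D^-1 * iota (d (cc i)).
  by apply: (mulIg (iota (d i))); rewrite mulVg -mulgA -iotaM d_cc mulVg.
have -> : (- k.+1%:Z = - 1 + - k%:Z)%R by lia.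
rewrite zpowD /conjg iotaM !mulgA.
by rewrite -[_ * Dz (-1)]mulgA mulgV mulg1.
Qed.

Lemma positiveP (w : word n) :
  positive iD i1 tau cc pp qq w <-> 1 <<= word_val iota d w.
Proof.
have [k [ey ->]] := fractionP w.
rewrite /positive -pr_eq1.
set s := (fraction _ _ _ w).2.
have ek : iota (pr (nseq k iD)) = Dz k.
  elim: k {ey} => [|k IH]; first by rewrite big_nil iota1.
  by rewrite big_cons iotaM IH d_iD; exact: esym (expgS D k).
have -> : pr (foldr (residue pp qq) (fraction iD tau cc w).1 s) = 1 <->
    leR (pr (foldr (residue pp qq) (fraction iD tau cc w).1 s)) 1.
  split=> [->|[c e]]; first by exists 1; rewrite mulg1.
  by have c1 := mulM_eq1 e; rewrite c1 mul1g in e.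
rewrite -foldr_residueP mul1g ey; split=> [[c e]|/ge1P[c e]].
  by rewrite -e iotaM ek -mulgA -zpowD GRing.addrN mulg1; exact: ge1_iota.
by exists c; apply: iota_inj; rewrite iotaM ek -e -mulgA -zpowD GRing.addNr mulg1.
Qed.

Lemma delta_words_val (w v : word n) : v \in delta_words iD w ->
  exists r, word_val iota d v = Dz r.
Proof.
rewrite /delta_words; elim: (wpow w n) v => [|l c IH] v.
  by rewrite inE => /eqP ->; exists 0%R; rewrite word_val_nil.
rewrite inE => /orP[/eqP ->|]; first by exists 0%R; rewrite word_val_nil.
case/flattenP=> t; rewrite !inE => /orP[]/eqP -> /mapP[u /IH[r ur] ->];
  rewrite word_val_cons /letter_val /= d_iD ur.
  by exists (1 + r)%R; rewrite zpowD.
by exists (-1 + r)%R; rewrite zpowD.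
Qed.

Lemma mem_delta_words (w : word n) r : `|r|%N <= size w * n ->
  exists2 v : word n, v \in delta_words iD w & word_val iota d v = Dz r.
Proof.
move=> rw; pose b := (r < 0)%R.
exists (nseq `|r|%N (iD, b)).
  apply: mem_words_upto; first by rewrite size_nseq size_wpow.
  by move=> l; rewrite mem_nseq !inE /b => /andP[_ /eqP ->]; case: (r < 0)%R; rewrite eqxx ?orbT.
have val_nseq k : word_val iota d (nseq k (iD, b)) = letter_val iota d (iD, b) ^+ k.
  elim: k => [|k IH]; first exact: word_val_nil.
  by rewrite word_val_cons IH expgS.
rewrite val_nseq /letter_val /b; case: r {rw b val_nseq} => k /=; first by rewrite d_iD.
by rewrite d_iD expVgn.
Qed.

Lemma dominatesP (v h h' : word n) k r : word_val iota d v = Dz (- r)%R ->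
  dominates iD i1 tau cc pp qq v h h' k <->
  (Dz r <<= word_val iota d h' ^+ k -> Dz r <<= word_val iota d h ^+ k).
Proof.
move=> vr.
have test (u : word n) : positive iD i1 tau cc pp qq (v ++ wpow u k) <->
    Dz r <<= word_val iota d u ^+ k.
  rewrite positiveP word_val_cat word_val_wpow vr -(leG_mul2l (Dz r)).
  by rewrite mulgA -zpowD GRing.addrN mul1g mulg1.
by rewrite /dominates -!test; split=> [/implyP|/implyP].
Qed.

(** Only exponents between -lk and lk matter: Delta^r below a conjugate of g^k forces r <= lk, and
    Delta^(-lk) is already below g^k. *)
Lemma inf_dominates_optimum (l k : nat) g h h' :
  0 < k <= n -> within l g -> inf_dominates (g ^+ k) (h' ^+ k) ->
  (forall r, `|r|%N <= l * n -> Dz r <<= h' ^+ k -> Dz r <<= h ^+ k) ->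
  inf_dominates (g ^+ k) (h ^+ k).
Proof.
move=> kn [lo up] opt H x r rx.
have rl := inf_conj_le rx (leG_XD k up).
have [lr|rl'] := boolP (- l%:Z * k%:Z <= r)%R.
  by apply: H (opt _ _ rx); nia.
apply: (@leG_trans (Dz (- l%:Z * k%:Z)%R)); first by apply: leG_Dz; lia.
apply: H; first by nia.
by apply: (opt 1); rewrite conjg1; exact: leG_DX.
Qed.

Lemma optimalP (w u : word n) : u \in conjugates w ->
  optimal iD i1 tau cc pp qq w u <-> forall k,
    inf_dominates (word_val iota d w ^+ k) (word_val iota d u ^+ k) /\
    inf_dominates ((word_val iota d w)^-1 ^+ k) ((word_val iota d u)^-1 ^+ k).
Proof.
move=> uw; set g := word_val iota d w; set h := word_val iota d u; split=> [opt|opt].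
  (* A stable element [h'] is itself a candidate, so passing the test against it makes [u] as good
     as [h']. *)
  have [x xP] := stable_exists g; set h' := g ^ x in xP.
  have h'w : within (size w) h'.
    have [] := xP 1%N; rewrite !expg1.
    exact: inf_dominates_within (word_val_bound w).
  have [u' u'w u'E] := conjugatesP h'w (ex_intro _ x erefl).
  have check r k : `|r|%N <= size w * n -> 0 < k <= n ->
      (Dz r <<= h' ^+ k -> Dz r <<= h ^+ k) /\
      (Dz r <<= h'^-1 ^+ k -> Dz r <<= h^-1 ^+ k).
    move=> rw kn; have [|v vw vr] := @mem_delta_words w (- r)%R; first by rewrite abszN.
    move/allP: opt => /(_ u' u'w) /allP /(_ v vw) /allP /(_ k).
    rewrite mem_iota add1n ltnS => /(_ kn)/andP[/(dominatesP _ _ _ vr) + /(dominatesP _ _ _ vr)].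
    by rewrite !word_val_winv u'E.
  have gw : within (size w) g^-1 by exact: within_inv (word_val_bound w).
  move=> k; split; apply: inf_dominates_powers => j jn.
    apply: (inf_dominates_optimum jn (word_val_bound w) (xP j).1) => r rw.
    exact: (check r j rw jn).1.
  apply: (inf_dominates_optimum jn gw (xP j).2) => r rw.
  exact: (check r j rw jn).2.
apply/allP => u' /conjugates_conj[x u'x]; apply/allP => v /delta_words_val[r vr].
have {}vr : word_val iota d v = Dz (- - r)%R by rewrite GRing.opprK.
apply/allP => k _; have [H1 H2] := opt k; apply/andP; split.
  by apply/(dominatesP _ _ _ vr); rewrite u'x -conjXg; exact: H1.
by apply/(dominatesP _ _ _ vr); rewrite !word_val_winv u'x -conjVg -conjXg; exact: H2.
Qed.

(** * Super summit sets in terms of domination *)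

Lemma is_inf_exists g : exists r, is_inf iota Delta g r.
Proof.
have [k [lo up]] := D_bounds g.
apply: (@int_max _ (- k%:Z)%R k) => // r rg.
by apply: (@inf_conj_le g 1) up; rewrite conjg1.
Qed.

Lemma inf_summitP g h : conj_class g h ->
  (exists2 r, is_inf iota Delta h r & is_inf_s iota Delta g r) <-> inf_dominates g h.
Proof.
move=> gh; split=> [[r [rh _] [_ rmax]] x r' r'x|dom].
  have [s [sx smax]] := is_inf_exists (g ^ x).
  apply: leG_trans rh; apply: leG_Dz.
  have : (r' <= s)%R by exact: smax.
  have : (s <= r)%R by apply: rmax; exists (g ^ x); [exists x | split].
  by lia.
have [r rinf] := is_inf_exists h; exists r => //; split; first by exists h.
by move=> r' [h' [x ->] [/dom r'h _]]; apply: rinf.2.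
Qed.

Lemma is_sup_inv g r : is_sup iota Delta g r <-> is_inf iota Delta g^-1 (- r)%R.
Proof.
split=> -[P Pm]; split.
- by apply/leG_invD; rewrite GRing.opprK.
- by move=> s /leG_invD/Pm; lia.
- by move/leG_invD: P; rewrite GRing.opprK.
- move=> s gs; suff : (- s <= - r)%R by lia.
  by apply: Pm; apply/leG_invD; rewrite GRing.opprK.
Qed.

Lemma is_sup_s_inv g r : is_sup_s iota Delta g r <-> is_inf_s iota Delta g^-1 (- r)%R.
Proof.
split=> -[[_ [x ->] hr] rmax]; split.
- by exists (g^-1 ^ x); [exists x | rewrite conjVg; apply/is_sup_inv].
- move=> s [_ [y ->] ys]; suff : (r <= - s)%R by lia.
  by apply: rmax; exists (g ^ y); [exists y | apply/is_sup_inv; rewrite GRing.opprK -conjVg].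
- by exists (g ^ x); [exists x | apply/is_sup_inv; rewrite -conjVg].
- move=> s [_ [y ->] /is_sup_inv ys]; suff : (- s <= - r)%R by lia.
  by apply: rmax; exists (g^-1 ^ y); [exists y | rewrite conjVg].
Qed.

Lemma super_summitP g h : super_summit_set iota Delta g h <->
  [/\ conj_class g h, inf_dominates g h & inf_dominates g^-1 h^-1].
Proof.
have conjV : conj_class g h -> conj_class g^-1 h^-1.
  by case=> x ->; exists x; rewrite conjVg.
split=> [[gh inf [s hs gs]]|[gh inf sup]].
  split=> //; first by apply/inf_summitP.
  by apply/(inf_summitP (conjV gh)); exists (- s)%R; [apply/is_sup_inv | apply/is_sup_s_inv].
split=> //; first by apply/inf_summitP.
have [s hs gs] := (inf_summitP (conjV gh)).2 sup.
by exists (- s)%R; [apply/is_sup_inv | apply/is_sup_s_inv]; rewrite GRing.opprK.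
Qed.

Lemma stableP g h : stable_super_summit_set iota Delta g h <->
  conj_class g h /\ forall k,
    inf_dominates (g ^+ k) (h ^+ k) /\ inf_dominates (g^-1 ^+ k) (h^-1 ^+ k).
Proof.
split=> [[/super_summitP[gh _ _] sss]|[gh dom]].
  split=> // -[|k]; first by split=> x r; rewrite !expg0 conj1g.
  by have /super_summitP[_ inf sup] := sss k.+1 isT; rewrite !expVgn.
split=> [|k _]; apply/super_summitP.
  by have [inf sup] := dom 1%N; split.
have [inf sup] := dom k; split=> //; last by rewrite -!expVgn.
by case: gh => x ->; exists x; rewrite conjXg.
Qed.

Lemma stable_wordsP (w : word n) h :
  stable_super_summit_set iota Delta (word_val iota d w) h <->
  exists2 u : word n, u \in stable_words iD i1 tau cc pp qq w & word_val iota d u = h.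
Proof.
rewrite stableP; split=> [[gh dom]|[u]].
  have hw : within (size w) h.
    have [] := dom 1%N; rewrite !expg1.
    exact: inf_dominates_within (word_val_bound w).
  have [u uw uh] := conjugatesP hw gh.
  by exists u; rewrite // mem_filter uw andbT; apply/(optimalP uw); rewrite uh.
rewrite mem_filter => /andP[/optimalP opt uw] <-.
by split; [exact: conjugates_conj uw | exact: opt].
Qed.

End Decision.

(** The tables depend on the monoid only, so their mere existence suffices to fix one program for
    all words. *)
Lemma decision_tables : exists (iD i1 : 'I_n) (tau cc : 'I_n -> 'I_n)
    (pp qq : 'I_n -> 'I_n -> 'I_n),
  [/\ d iD = Delta, d i1 = 1, forall i, d (cc i) * d i = Delta &
   [/\ forall i, iota (d (tau i)) = iota (d i) ^ D,
     forall a b, d (pp a b) * d a = d (qq a b) * d b &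
     forall a b c, leR (d b) (c * d a) -> leR (d (pp a b)) c]].
Proof.
have leLR a := (garside_delta GM).1 a.
have simpleL i : leL (d i) Delta by apply/(Hd.2 _); exists i.
have simpleR i : leR (d i) Delta by apply/leLR.
have [iD iDE] : exists i, d i = Delta by apply/(Hd.2 _); exists 1; rewrite mulg1.
have [i1 i1E] : exists i, d i = 1 by apply/(Hd.2 _); exists Delta; rewrite mul1g.
have /choice[cc ccP] : forall i, exists j, d j * d i = Delta.
  move=> i; have [c ci] := simpleR i.
  by have [|j jc] := (Hd.2 c).1; [exists (d i) | exists j; rewrite jc].
have /choice[tau tauP] : forall i, exists j, iota (d j) = iota (d i) ^ D.
  by move=> i; have [[j ->] _] := simple_conjD i; exists j.
have /choice[pq pqP] : forall ab : 'I_n * 'I_n, exists pq : 'I_n * 'I_n,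
    d pq.1 * d ab.1 = d pq.2 * d ab.2 /\
    forall c, leR (d ab.2) (c * d ab.1) -> leR (d pq.1) c.
  case=> a b /=; have [_ [j [[p pa] [q qb] jm]]] := garside_latticeR GM (d a) (d b).
  have /leLR[e ej] : leR j Delta by apply: jm.
  have [|p' pE] := (Hd.2 p).1; first by exists (d a * e); rewrite mulgA pa.
  have [|q' qE] := (Hd.2 q).1; first by exists (d b * e); rewrite mulgA qb.
  exists (p', q'); rewrite /= pE qE pa qb; split=> // c bc.
  have [|f fj] := jm (c * d a) _ bc; first by exists c.
  by exists f; apply: (garside_cancelR GM (a := d a)); rewrite -mulgA pa.
exists iD, i1, tau, cc, (fun a b => (pq (a, b)).1), (fun a b => (pq (a, b)).2).
by split=> //; split=> // a b; have [] := pqP (a, b).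
Qed.

End Garside.

Theorem theoremB (M : monoidType) (G : groupType) (iota : M -> G) (Delta : M)
    (n : nat) (d : 'I_n -> M) :
  garside_monoid Delta ->
  group_of_fractions iota ->
  (exists a : M, a <> 1%g) ->
  enumerates_simples Delta d ->
  exists algo : prog, forall w : word n, exists out : seq (word n),
    returns algo [:: word_code w] (words_code out) /\
    forall h : G,
      stable_super_summit_set iota Delta (word_val iota d w) h <->
      exists2 u : word n, u \in out & word_val iota d u = h.
Proof.
move=> GM GF nontrivial Hd.
have [iD [i1 [tau [cc [pp [qq [iDE i1E ccP [tauP pqE pqP]]]]]]]] :=
  decision_tables GM GF Hd.
have [algo algoP] := comp_stable_words iD i1 tau cc pp qq.
exists algo => w; exists (stable_words iD i1 tau cc pp qq w); split; first exact: algoP.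
by move=> h; apply: (stable_wordsP GM GF nontrivial Hd).
Qed.
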